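(* Let $K\ge1$, $N>1$, $\alpha>1$ with $M=\alpha KN$ an integer. Then $$\bar\beta_{\mathrm{BD\text{-}ZF}}:=\bar\beta_{\mathrm{DPC\text{-}ZF}}(M,KN)-\bar\beta_{\mathrm{DPC\text{-}BD}}(M,K,N)=\log_2 e\cdot K\sum_{j=1}^{N-1}\frac{N-j}{(\alpha-1)KN+j}\quad\text{(bits/s/Hz)},$$ and the corresponding power offset $\bar\Delta_{\mathrm{BD\text{-}ZF}}=\frac{3}{KN}\bar\beta_{\mathrm{BD\text{-}ZF}}$ equals $\frac{3\log_2 e}{N}\sum_{j=1}^{N-1}\frac{N-j}{(\alpha-1)KN+j}$ dB.
   Context: MIMO broadcast channel with $M$ transmit antennas and $K$ users with $N$ antennas each, user channels $\mathbf H_k\in\mathbb C^{N\times M}$ stacked into $\mathbf H\in\mathbb C^{KN\times M}$ with i.i.d. zero-mean unit-variance circularly-symmetric complex Gaussian entries, unit noise, total power $P$. $\mathcal C_{\mathrm{DPC}}(\mathbf H,P)=\max\{\log_2|\mathbf I+\sum_k\mathbf H_k^H\mathbf Q_k\mathbf H_k| : \mathbf Q_k\succeq0,\ \sum_k\mathrm{tr}\mathbf Q_k\le P\}$. Zero-forcing: for each row $\mathbf h_{k,n}$ of $\mathbf H$, $|g_{k,n}|$ is the norm of the projection of $\mathbf h_{k,n}$ onto the orthogonal complement of the span of the other rows; $\mathcal C_{\mathrm{ZF}}(\mathbf H,P)=\max_{P_{k,n}\ge0,\sum P_{k,n}\le P}\sum_{k,n}\log_2(1+P_{k,n}|g_{k,n}|^2)$.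 Block diagonalization: $\mathbf V_k$ is an $M\times(M-(K-1)N)$ matrix with orthonormal columns spanning the null space of $\{\mathbf H_j\}_{j\ne k}$, $\mathbf G_k=\mathbf H_k\mathbf V_k$, and $\mathcal C_{\mathrm{BD}}(\mathbf H,P)=\max\{\sum_k\log_2|\mathbf I+\mathbf G_k\mathbf Q_k\mathbf G_k^H| : \mathbf Q_k\succeq0,\ \sum_k\mathrm{tr}\mathbf Q_k\le P\}$. Define $\bar\beta_{\mathrm{DPC\text{-}ZF}}(M,KN)=\mathbb E[\lim_{P\to\infty}(\mathcal C_{\mathrm{DPC}}-\mathcal C_{\mathrm{ZF}})]$ and $\bar\beta_{\mathrm{DPC\text{-}BD}}(M,K,N)=\mathbb E[\lim_{P\to\infty}(\mathcal C_{\mathrm{DPC}}-\mathcal C_{\mathrm{BD}})]$. *)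

(* Defs.v *)
From HB Require Import structures.
From mathcomp Require Import all_boot all_order all_algebra.
From mathcomp Require Import all_classical all_reals all_analysis.
From mathcomp Require Import complex.

Set Implicit Arguments.
Unset Strict Implicit.
Unset Printing Implicit Defensive.

Import Order.TTheory GRing.Theory Num.Theory.
Local Open Scope classical_set_scope.
Local Open Scope ring_scope.

Section MIMO.
Variable R : realType.
Local Notation C := (R[i]).

Definition conjT m n (A : 'M[C]_(m, n)) : 'M[C]_(n, m) := (map_mx (@conjc R) A)^T.

Definition log2 (x : R) : R := ln x / ln 2.

Definition psd n (A : 'M[C]_n) : Prop :=
  conjT A = A /\ forall x : 'cV[C]_n, 0 <= complex.Re ((conjT x *m A *m x) 0 0).

(* real part of the trace (trace of a Hermitian matrix is real) *)
Definition rtr n (A : 'M[C]_n) : R := complex.Re (\tr A).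

(* log2 of the determinant (of a Hermitian PD matrix, which is real) *)
Definition logdet n (A : 'M[C]_n) : R := log2 (complex.Re (\det A)).

(* the channel H_k (N x M) of user k, i.e. the rows k*N .. k*N+N-1 of H *)
Definition user_ch K N M (H : 'M[C]_(K * N, M)) (k : 'I_K) : 'M[C]_(N, M) :=
  \matrix_(n < N, j < M) H (mxvec_index k n) j.

Definition C_DPC K N M (H : 'M[C]_(K * N, M)) (P : R) : R :=
  sup [set c | exists Q : 'I_K -> 'M[C]_N,
         (forall k, psd (Q k)) /\ \sum_(k < K) rtr (Q k) <= P /\
         c = logdet (1%:M + \sum_(k < K)
                 conjT (user_ch H k) *m Q k *m user_ch H k)].

Definition inner n (u v : 'rV[C]_n) : C := \sum_(l < n) u 0 l * conjc (v 0 l).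
Definition vnorm2 n (u : 'rV[C]_n) : R := complex.Re (inner u u).

(* p is the projection of row i of H onto the orthogonal complement of the
   span of the other rows *)
Definition is_zf_proj m n (H : 'M[C]_(m, n)) (i : 'I_m) (p : 'rV[C]_n) : Prop :=
  (forall j, j != i -> inner p (row j H) = 0) /\
  exists c : 'I_m -> C, row i H - p = \sum_(j < m | j != i) c j *: row j H.

Definition zf_proj m n (H : 'M[C]_(m, n)) (i : 'I_m) : 'rV[C]_n :=
  match pselect (exists p, is_zf_proj H i p) with
  | left e => projT1 (cid e)
  | right _ => 0
  end.

Definition zf_gain2 m n (H : 'M[C]_(m, n)) (i : 'I_m) : R := vnorm2 (zf_proj H i).

Definition C_ZF m n (H : 'M[C]_(m, n)) (P : R) : R :=
  sup [set c | exists Pw : 'I_m -> R,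
         (forall i, 0 <= Pw i) /\ \sum_(i < m) Pw i <= P /\
         c = \sum_(i < m) log2 (1 + Pw i * zf_gain2 H i)].

Definition bd_dim (K N M : nat) : nat := (M - (K - 1) * N)%N.

Definition bd_ok K N M (H : 'M[C]_(K * N, M)) (k : 'I_K) d (V : 'M[C]_(M, d)) : Prop :=
  conjT V *m V = 1%:M /\
  (forall j, j != k -> user_ch H j *m V = 0) /\
  (forall x : 'cV[C]_M, (forall j, j != k -> user_ch H j *m x = 0) ->
     exists y : 'cV[C]_d, x = V *m y).

Definition bd_basis K N M (H : 'M[C]_(K * N, M)) (k : 'I_K) : 'M[C]_(M, bd_dim K N M) :=
  match pselect (exists V, bd_ok H k V) with
  | left e => projT1 (cid e)
  | right _ => 0
  end.

Definition bd_G K N M (H : 'M[C]_(K * N, M)) (k : 'I_K) : 'M[C]_(N, bd_dim K N M) :=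
  user_ch H k *m bd_basis H k.

Definition C_BD K N M (H : 'M[C]_(K * N, M)) (P : R) : R :=
  sup [set c | exists Q : 'I_K -> 'M[C]_(bd_dim K N M),
         (forall k, psd (Q k)) /\ \sum_(k < K) rtr (Q k) <= P /\
         c = \sum_(k < K) logdet (1%:M + bd_G H k *m Q k *m conjT (bd_G H k))].

Definition beta_DPC_ZF K N M (H : 'M[C]_(K * N, M)) : R :=
  lim ((fun P : R => C_DPC H P - C_ZF H P) x @[x --> +oo]).
Definition beta_DPC_BD K N M (H : 'M[C]_(K * N, M)) : R :=
  lim ((fun P : R => C_DPC H P - C_BD H P) x @[x --> +oo]).

End MIMO.

(* real and imaginary parts of all entries are mutually independent
   N(0, 1/2) random variables *)
Definition entry_rv (R : realType) (T : Type) m n (H : T -> 'M[R[i]]_(m, n))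
  (t : 'I_m * 'I_n * bool) (w : T) : R :=
  if t.2 then complex.Re (H w t.1.1 t.1.2) else complex.Im (H w t.1.1 t.1.2).

Definition iid_CN01 (R : realType) (d : measure_display) (T : measurableType d)
  (Pr : probability T R) m n (H : T -> 'M[R[i]]_(m, n)) : Prop :=
  (forall t, measurable_fun setT (entry_rv H t)) /\
  (forall t (A : set R), measurable A ->
     Pr (entry_rv H t @^-1` A) = normal_prob 0 (Num.sqrt (2^-1)) A) /\
  (forall (J : {set 'I_m * 'I_n * bool}) (A : 'I_m * 'I_n * bool -> set R),
     (forall t, measurable (A t)) ->
     Pr [set w | forall t, t \in J -> A t (entry_rv H t w)] =
       (\prod_(t in J) Pr (entry_rv H t @^-1` A t))%E).

(* Main.v *)
Require Import Defs.
From HB Require Import structures.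
From mathcomp Require Import all_boot all_order all_algebra.
From mathcomp Require Import all_classical all_reals all_analysis.
From mathcomp Require Import measurable_realfun.
From mathcomp Require Import complex.
From mathcomp Require Import ring lra.
From mathcomp Require Import zify.
Set Implicit Arguments.
Unset Strict Implicit.
Unset Printing Implicit Defensive.
Import Order.TTheory GRing.Theory Num.Theory.
Import numFieldNormedType.Exports.
Local Open Scope classical_set_scope.
Local Open Scope ring_scope.

(** With power [P], each of the three capacities equals
    [m * log2 (P / m) + log2 D + o(1)], where [m = K * N] and [D] is the Gram
    determinant of the channel (DPC), the product of the zero-forcing gains (ZF),
    or the product over the users of the Gram determinants of [bd_G] (BD); so
    both limits are differences of [log2 D]'s.  Such a Gram determinant is a
    product of squared distances [gain s a] from a row to the span of previous
    rows, so only [E (ln (gain s a))] matters.  For i.i.d. Gaussian rows,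
    conditioning on [s] gives the Laplace transform
    [E (expR (- t * gain s a)) = (1 + t) ^- (n - size s)], and Frullani's integral
    [ln b - ln a = \int (expR (- t * a) - expR (- t * b)) / t] turns the removal of
    one row from [s] into the increment [(n - size s - 1)^-1] of the mean;
    the DPC terms cancel and the remaining increments sum up to the formula. *)

(** * Hermitian matrices and projections *)

Section HermitianMatrices.
Variable R : realType.
Local Notation C := (R[i]).
Local Notation Re := (@complex.Re R).
Local Notation Im := (@complex.Im R).
Local Notation "x %:C" := (real_complex R x).

(** No single mean of [ln (gain s a)] is ever evaluated: the means only exist as unknown reals, and
    they cancel because the zero-forcing and the block-diagonalization terms of a row both start
    from its mean against all the other rows. The coefficient [N - j] counts rows: within a user,
    the successive rows are released from [N - 1], ..., [0] rows of the same user, and the [j]-th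
    release, worth [(D + j)^-1] with [D = M - K * N], happens for [N - j] of them. Gram-Schmidt is a
    total recursion on lists instead of a statement on ranks or bases: gains are then visibly
    measurable in the entries, and linear independence is the nonvanishing of gains. The Laplace
    transform requires independence of the conditioning rows almost surely, and it is itself what
    yields independence with one more row, so both grow in the same induction. Taking it for all
    [t > -1] gives, at a negative [t], control of large gains as well. *)

Lemma ReD (x y : C) : Re (x + y) = Re x + Re y. Proof. by case: x y => [? ?] []. Qed.
Lemma ReN (x : C) : Re (- x) = - Re x. Proof. by case: x. Qed.
Lemma ImD (x y : C) : Im (x + y) = Im x + Im y. Proof. by case: x y => [? ?] []. Qed.
Lemma ImN (x : C) : Im (- x) = - Im x. Proof. by case: x. Qed.
Lemma ReM (x y : C) : Re (x * y) = Re x * Re y - Im x * Im y.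
Proof. by case: x y => [? ?] []. Qed.
Lemma ImM (x y : C) : Im (x * y) = Re x * Im y + Im x * Re y.
Proof. by case: x y => [? ?] []. Qed.
Lemma Re_sum (I : Type) (r : seq I) (P : pred I) (F : I -> C) :
  Re (\sum_(i <- r | P i) F i) = \sum_(i <- r | P i) Re (F i).
Proof. by apply: (big_morph Re ReD). Qed.
Lemma ReRM (a : R) (x : C) : Re (a%:C * x) = a * Re x.
Proof. by rewrite ReM /= mul0r subr0. Qed.
Lemma realCM (x y : R) : (x * y)%:C = x%:C * y%:C.
Proof. exact: rmorphM. Qed.
Lemma conjc_fix_real (x : C) : conjc x = x -> x = (Re x)%:C.
Proof. case: x => a b /= [hb]; congr Complex; lra. Qed.
Lemma mulcJ_real (x : C) : x * conjc x = (Re x ^+ 2 + Im x ^+ 2)%:C.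
Proof. case: x => a b /=; apply/eqP; rewrite eq_complex /=; apply/andP; split; apply/eqP; ring. Qed.

Lemma conjTE m n (A : 'M[C]_(m, n)) i j : conjT A i j = conjc (A j i).
Proof. by rewrite !mxE. Qed.
Lemma conjTK m n (A : 'M[C]_(m, n)) : conjT (conjT A) = A.
Proof. by apply/matrixP=> i j; rewrite !conjTE conjcK. Qed.
Lemma conjTM m n p (A : 'M[C]_(m, n)) (B : 'M[C]_(n, p)) :
  conjT (A *m B) = conjT B *m conjT A.
Proof. by rewrite /conjT map_mxM trmx_mul. Qed.
Lemma conjTD m n (A B : 'M[C]_(m, n)) : conjT (A + B) = conjT A + conjT B.
Proof. by rewrite /conjT map_mxD linearD. Qed.
Lemma conjTN m n (A : 'M[C]_(m, n)) : conjT (- A) = - conjT A.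
Proof. by rewrite /conjT map_mxN linearN. Qed.
Lemma conjTB m n (A B : 'M[C]_(m, n)) : conjT (A - B) = conjT A - conjT B.
Proof. by rewrite conjTD conjTN. Qed.
Lemma conjT0 m n : conjT (0 : 'M[C]_(m, n)) = 0.
Proof. by rewrite /conjT map_mx0 trmx0. Qed.
Lemma conjTZ m n (a : C) (A : 'M[C]_(m, n)) : conjT (a *: A) = conjc a *: conjT A.
Proof. by rewrite /conjT map_mxZ linearZ. Qed.
Lemma conjTZr m n (a : R) (A : 'M[C]_(m, n)) : conjT (a%:C *: A) = a%:C *: conjT A.
Proof. by rewrite conjTZ conjc_real. Qed.
Lemma conjT_scalar n (a : R) : conjT (a%:C%:M : 'M[C]_n) = a%:C%:M.
Proof. by rewrite /conjT map_scalar_mx tr_scalar_mx /= oppr0. Qed.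
Lemma conjT1 n : conjT (1%:M : 'M[C]_n) = 1%:M.
Proof. by have := conjT_scalar n 1; rewrite rmorph1. Qed.
Lemma conjT_sum m n (I : Type) (r : seq I) (P : pred I) (F : I -> 'M[C]_(m, n)) :
  conjT (\sum_(i <- r | P i) F i) = \sum_(i <- r | P i) conjT (F i).
Proof. by apply: (big_morph (@conjT R m n) (@conjTD m n)); apply: conjT0. Qed.
Lemma conjT_col_mx m1 m2 n (A : 'M[C]_(m1, n)) (B : 'M[C]_(m2, n)) :
  conjT (col_mx A B) = row_mx (conjT A) (conjT B).
Proof. by rewrite /conjT map_col_mx tr_col_mx. Qed.
Lemma conjT_block m1 m2 n1 n2 (A : 'M[C]_(m1, n1)) B D (E : 'M[C]_(m2, n2)) :
  conjT (block_mx A B D E) = block_mx (conjT A) (conjT D) (conjT B) (conjT E).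
Proof. by rewrite /conjT map_block_mx tr_block_mx. Qed.
Lemma det_conjT n (A : 'M[C]_n) : \det (conjT A) = conjc (\det A).
Proof. by rewrite /conjT det_tr det_map_mx. Qed.
Lemma conjT_unit n (A : 'M[C]_n) : (conjT A \in unitmx) = (A \in unitmx).
Proof. by rewrite !unitmxE det_conjT !unitfE conjc_eq0. Qed.
Lemma conjT_inv n (A : 'M[C]_n) : A \in unitmx -> conjT (invmx A) = invmx (conjT A).
Proof.
move=> uA; have uA' : conjT A \in unitmx by rewrite conjT_unit.
apply: (can_inj (mulKmx uA')); rewrite mulmxV// -conjTM mulVmx// conjT1//.
Qed.

Lemma scalar_mxDE n (a b : C) : a%:M + b%:M = (a + b)%:M :> 'M[C]_n.
Proof. by rewrite raddfD. Qed.

Lemma mx11E (A : 'M[C]_1) : A = (A 0 0)%:M.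
Proof. exact: mx11_scalar. Qed.

(** Sylvester's identity: pulling the same lower triangular factor out of one block matrix on the
    left or on the right leaves either determinant. *)
Lemma det_mulmx_one_addC m n (A : 'M[C]_(m, n)) (B : 'M[C]_(n, m)) :
  \det (1%:M + A *m B) = \det (1%:M + B *m A).
Proof.
have e1 : block_mx 1%:M A (- B) 1%:M =
    block_mx 1%:M 0 (- B) 1%:M *m block_mx 1%:M A 0 (1%:M + B *m A).
  by rewrite mulmx_block !mul1mx !mulmx1 !mul0mx !addr0 mulNmx addrCA addNr addr0.
have e2 : block_mx 1%:M A (- B) 1%:M =
    block_mx (1%:M + A *m B) A 0 1%:M *m block_mx 1%:M 0 (- B) 1%:M.
  rewrite mulmx_block !mul1mx !mulmx1 !mul0mx !mulmx0 !add0r mulmxN.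
  by rewrite addrK.
have := congr1 determinant e1; rewrite e2 !det_mulmx !det_lblock !det_ublock !det1.
by rewrite !mul1r !mulr1.
Qed.

Lemma det_schur n (g : C) (u : 'M[C]_(1, n)) (v : 'M[C]_(n, 1)) (D : 'M[C]_n) :
  g != 0 -> \det (block_mx g%:M u v D) = g * \det (D - g^-1 *: (v *m u)).
Proof.
move=> g0; have -> : block_mx g%:M u v D =
   block_mx 1%:M 0 (g^-1 *: v) 1%:M *m block_mx g%:M u 0 (D - g^-1 *: (v *m u)).
  rewrite mulmx_block !mul1mx !mul0mx !addr0 mul_mx_scalar scalerA divff// scale1r.
  by rewrite -scalemxAl addrC subrK.
by rewrite det_mulmx det_lblock det_ublock !det1 !mul1r det_scalar1.
Qed.

(** * Positive definite matrices and their determinants *)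

Definition posdef n (A : 'M[C]_n) : Prop :=
  conjT A = A /\ forall x : 'cV[C]_n, x != 0 -> 0 < Re ((conjT x *m A *m x) 0 0).

Lemma Re_normsq n (x : 'cV[C]_n) :
  (conjT x *m x) 0 0 = (\sum_i (Re (x i 0) ^+ 2 + Im (x i 0) ^+ 2))%:C.
Proof.
rewrite mxE rmorph_sum; apply: eq_bigr => i _.
by rewrite conjTE mulrC mulcJ_real.
Qed.

Lemma normsq_ge0 n (x : 'cV[C]_n) : 0 <= Re ((conjT x *m x) 0 0).
Proof. by rewrite Re_normsq /=; apply: sumr_ge0 => i _; rewrite addr_ge0// sqr_ge0. Qed.

Lemma normsq_eq0 n (x : 'cV[C]_n) : Re ((conjT x *m x) 0 0) = 0 -> x = 0.
Proof.
rewrite Re_normsq /= => /eqP; rewrite psumr_eq0; last first.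
  by move=> i _; rewrite addr_ge0// sqr_ge0.
move=> /allP h; apply/matrixP => i j; rewrite (ord1 j) !mxE.
have := h i (mem_index_enum i); rewrite /= paddr_eq0 ?sqr_ge0// !sqrf_eq0.
by case: (x i 0) => a b /= /andP[/eqP -> /eqP ->].
Qed.

Lemma posdef1 n : posdef (1%:M : 'M[C]_n).
Proof.
split; first exact: conjT1.
move=> x x0; rewrite mulmx1 lt_neqAle normsq_ge0 andbT.
by apply/negP => /eqP/esym/normsq_eq0 h; rewrite h eqxx in x0.
Qed.

Lemma posdef_psd n (A : 'M[C]_n) : posdef A -> psd A.
Proof.
move=> [hA pA]; split=> // x; have [->|/pA/ltW//] := eqVneq x 0.
by rewrite mulmx0 mxE.
Qed.

Lemma hermitian_congr n k (A : 'M[C]_n) (S : 'M[C]_(n, k)) :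
  conjT A = A -> conjT (conjT S *m A *m S) = conjT S *m A *m S.
Proof. by move=> hA; rewrite !conjTM conjTK hA mulmxA. Qed.

Lemma form_congr n k (A : 'M[C]_n) (S : 'M[C]_(n, k)) (x : 'cV[C]_k) :
  conjT x *m (conjT S *m A *m S) *m x = conjT (S *m x) *m A *m (S *m x).
Proof. by rewrite conjTM !mulmxA. Qed.

Lemma posdef_congr n k (A : 'M[C]_n) (S : 'M[C]_(n, k)) :
  posdef A -> (forall y : 'cV[C]_k, S *m y = 0 -> y = 0) ->
  posdef (conjT S *m A *m S).
Proof.
move=> [hA pA] iS; split; first exact: hermitian_congr.
move=> x x0; rewrite form_congr; apply: pA.
by apply: contra_neq x0 => /iS.
Qed.

Lemma psd_congr n k (A : 'M[C]_n) (S : 'M[C]_(n, k)) :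
  psd A -> psd (conjT S *m A *m S).
Proof.
move=> [hA pA]; split; first exact: hermitian_congr.
by move=> x; rewrite form_congr; apply: pA.
Qed.

Lemma psd_congrV n k (A : 'M[C]_n) (U : 'M[C]_(k, n)) :
  psd A -> psd (U *m A *m conjT U).
Proof. by move=> /(psd_congr (conjT U)); rewrite conjTK. Qed.

Lemma psd1 n : psd (1%:M : 'M[C]_n). Proof. exact/posdef_psd/posdef1. Qed.

Lemma psd_mulmx_conjT n k (S : 'M[C]_(n, k)) : psd (conjT S *m S).
Proof. by rewrite -[conjT S]mulmx1; apply/psd_congr/psd1. Qed.

Lemma posdefD_psd n (A B : 'M[C]_n) : posdef A -> psd B -> posdef (A + B).
Proof.
move=> [hA pA] [hB pB]; split; first by rewrite conjTD hA hB.
by move=> x x0; rewrite mulmxDr mulmxDl mxE ReD ltr_pwDl ?pA ?pB.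
Qed.

Lemma psdD n (A B : 'M[C]_n) : psd A -> psd B -> psd (A + B).
Proof.
move=> [hA pA] [hB pB]; split; first by rewrite conjTD hA hB.
by move=> x; rewrite mulmxDr mulmxDl mxE ReD addr_ge0 ?pA ?pB.
Qed.

Lemma psd0 n : psd (0 : 'M[C]_n).
Proof. by split=> [|x]; rewrite ?conjT0// mulmx0 mul0mx mxE. Qed.

Lemma psd_sum n (I : Type) (r : seq I) (P : pred I) (F : I -> 'M[C]_n) :
  (forall i, P i -> psd (F i)) -> psd (\sum_(i <- r | P i) F i).
Proof. by move=> h; apply: (big_ind (@psd R n)) h; [exact: psd0|exact: psdD]. Qed.

Lemma psdZ n (a : R) (A : 'M[C]_n) : 0 <= a -> psd A -> psd (a%:C *: A).
Proof.
move=> a0 [hA pA]; split; first by rewrite conjTZr hA.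
by move=> x; rewrite -scalemxAr -scalemxAl mxE ReRM mulr_ge0.
Qed.

Lemma posdefZ n (a : R) (A : 'M[C]_n) : 0 < a -> posdef A -> posdef (a%:C *: A).
Proof.
move=> a0 [hA pA]; split; first by rewrite conjTZr hA.
by move=> x x0; rewrite -scalemxAr -scalemxAl mxE ReRM mulr_gt0// pA.
Qed.

Lemma unitmx_cker n (A : 'M[C]_n) :
  (forall x : 'cV[C]_n, A *m x = 0 -> x = 0) -> A \in unitmx.
Proof.
move=> h; rewrite -unitmx_tr -row_free_unit -kermx_eq0; apply/eqP/row_matrixP => i.
rewrite row0; apply: trmx_inj; rewrite trmx0; apply: h.
have: row i (kermx A^T) *m A^T = 0 by rewrite -row_mul mulmx_ker row0.
by move=> /(congr1 trmx); rewrite trmx_mul trmxK trmx0.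
Qed.

Lemma unitmx_cinj n (A : 'M[C]_n) k (x : 'M[C]_(n, k)) : A \in unitmx -> A *m x = 0 -> x = 0.
Proof. by move=> uA /(congr1 (mulmx (invmx A))); rewrite mulKmx// mulmx0. Qed.

Lemma posdef_unit n (A : 'M[C]_n) : posdef A -> A \in unitmx.
Proof.
move=> [hA pA]; apply: unitmx_cker => x Ax; apply/eqP/negPn/negP => /pA.
by rewrite -mulmxA Ax mulmx0 mxE ltxx.
Qed.

Lemma psd_diag_ge0 n (A : 'M[C]_n) i : psd A -> A i i = (Re (A i i))%:C /\ 0 <= Re (A i i).
Proof.
move=> [hA pA]; split.
  by apply: conjc_fix_real; rewrite -conjTE hA.
have := pA (delta_mx i 0).
have -> : conjT (delta_mx i 0 : 'cV[C]_n) = delta_mx 0 i.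
  by apply/matrixP => a b; rewrite conjTE !mxE andbC; case: andP => _ /=; rewrite oppr0.
by rewrite -rowE -colE !mxE.
Qed.

Lemma posdef_diag_gt0 n (A : 'M[C]_n) i : posdef A -> A i i = (Re (A i i))%:C /\ 0 < Re (A i i).
Proof.
move=> [hA pA]; split.
  by apply: conjc_fix_real; rewrite -conjTE hA.
have := pA (delta_mx i 0).
have -> : conjT (delta_mx i 0 : 'cV[C]_n) = delta_mx 0 i.
  by apply/matrixP => a b; rewrite conjTE !mxE andbC; case: andP => _ /=; rewrite oppr0.
rewrite -rowE -colE !mxE; apply; apply/eqP => /matrixP/(_ i 0); rewrite !mxE !eqxx /=.
by move/eqP; rewrite oner_eq0.
Qed.

Lemma rtr_ge0 n (A : 'M[C]_n) : psd A -> 0 <= rtr A.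
Proof.
by move=> pA; rewrite /rtr Re_sum; apply: sumr_ge0 => i _; have [] := psd_diag_ge0 i pA.
Qed.

(** Induction through the Schur complement of the corner entry. The triangular shape with positive
    real diagonal later allows a Gaussian row to be integrated one coordinate at a time. *)
Lemma cholesky n (A : 'M[C]_n) : posdef A ->
  exists (L : 'M[C]_n) (r : 'I_n -> R), [/\ is_trig_mx L, forall i, L i i = (r i)%:C,
     forall i, 0 < r i & A = L *m conjT L].
Proof.
elim: n A => [|n IHn]; last rewrite -[n.+1]/(1 + n)%N; move=> A pA.
  exists 0, (fun=> 1); split=> //; first by apply/is_trig_mxP => -[].
  - by case.
  - by rewrite flatmx0 [RHS]flatmx0.
have [a_real a_gt0] := posdef_diag_gt0 (0 : 'I_(1 + n)) pA.
pose a := Re (A 0 0).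
rewrite -/a in a_real a_gt0.
pose b := dlsubmx A; pose D := drsubmx A.
have eA : A = block_mx a%:C%:M (conjT b) b D .
  rewrite -[LHS](@submxK _ 1 n 1 n); congr block_mx.
    rewrite [LHS]mx11E !mxE; congr (_%:M); rewrite -a_real; congr (A _ _); exact/val_inj.
  apply/matrixP => i j; rewrite conjTE !mxE -conjTE pA.1; by [].
have aC0 : a%:C != 0 :> C by rewrite fmorph_eq0 gt_eqF.
(* The top block makes the first row of [A *m S] vanish, so congruence by [S] yields the Schur
   complement, which inherits positivity. *)
pose S : 'M[C]_(1 + n, n) := col_mx (- a%:C^-1 *: conjT b) 1%:M.
have pS : posdef (D - a%:C^-1 *: (b *m conjT b)).
  have -> : D - a%:C^-1 *: (b *m conjT b) = conjT S *m A *m S.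
    rewrite -mulmxA eA /S mul_block_col conjT_col_mx mul_row_col !mulmx1 conjT1 mul1mx.
    rewrite mul_scalar_mx scalerA mulrN divff// scaleN1r addNr mulmx0 add0r.
    by rewrite -scalemxAr scaleNr addrC.
  apply: posdef_congr => // y /(congr1 (@dsubmx _ 1 n 1)).
  by rewrite /S mul_col_mx col_mxKd mul1mx => ->; apply/matrixP => i j; rewrite !mxE.
have [L' [r' [tL' dL' r'_gt0 eL']]] := IHn _ pS.
pose s := Num.sqrt a.
have s_gt0 : 0 < s by rewrite sqrtr_gt0.
have s2 : s * s = a by rewrite -expr2 sqr_sqrtr// ltW.
have sC0 : s%:C != 0 :> C by rewrite fmorph_eq0 gt_eqF.
exists (block_mx s%:C%:M 0 (s%:C^-1 *: b) L' : 'M[C]_(1 + n)),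
  (fun i : 'I_(1 + n) => match fintype.split i with inl _ => s | inr j => r' j end).
split.
- by rewrite is_trig_block_mx// eqxx tL' andbT scalar_mx_is_trig.
- move=> i; rewrite -(fintype.splitK i); case: (fintype.split i) => j /=.
    by rewrite (fintype.unsplitK (inl j)) block_mxEul (ord1 j) !mxE eqxx.
  by rewrite (fintype.unsplitK (inr j)) block_mxEdr dL'.
- by move=> i; case: (fintype.split i) => [_|j]; [exact: s_gt0|exact: r'_gt0].
- rewrite eA conjT_block mulmx_block conjT0 !mul0mx !mulmx0 !addr0 conjT_scalar -scalar_mxM.
  rewrite -rmorphM s2; congr block_mx.
  + by rewrite mul_scalar_mx conjTZ scalerA conjc_inv conjc_real divff// scale1r.
  + by rewrite mul_mx_scalar scalerA divff// scale1r.
  + rewrite -eL' conjTZ -scalemxAl -scalemxAr scalerA conjc_inv conjc_real -invfM -rmorphM s2.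
    by rewrite addrC subrK.
Qed.

Lemma trig_gram_det n (L : 'M[C]_n) (r : 'I_n -> R) :
  is_trig_mx L -> (forall i, L i i = (r i)%:C) ->
  \det (L *m conjT L) = (\prod_i r i ^+ 2)%:C.
Proof.
move=> tL dL; rewrite det_mulmx det_conjT det_trig//.
rewrite (eq_bigr (fun i => (r i)%:C))// -rmorph_prod conjc_real -rmorphM.
by congr (_%:C); rewrite -expr2 prodrXl.
Qed.

Lemma posdef_det n (A : 'M[C]_n) : posdef A -> \det A = (Re (\det A))%:C /\ 0 < Re (\det A).
Proof.
move=> /cholesky[L [r [tL dL r0 ->]]]; rewrite (trig_gram_det tL dL); split => //=.
by apply: prodr_gt0 => i _; rewrite exprn_gt0.
Qed.

(** The entry [A i i] is the squared norm of row [i] of the Cholesky factor, hence at least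
    [r i ^+ 2]. *)
Lemma hadamard_ineq n (A : 'M[C]_n) : posdef A -> Re (\det A) <= \prod_i Re (A i i).
Proof.
move=> /cholesky[L [r [tL dL r0 ->]]]; rewrite (trig_gram_det tL dL) /=.
apply: ler_prod => i _; rewrite sqr_ge0/= mxE Re_sum (bigD1 i)//= conjTE mulcJ_real dL /=.
rewrite expr0n /= addr0 lerDl; apply: sumr_ge0 => j _.
by rewrite conjTE mulcJ_real /= addr_ge0 ?sqr_ge0.
Qed.

Lemma prod_le_mean n (x : 'I_n -> R) : (forall i, 0 <= x i) ->
  \prod_i x i <= ((\sum_i x i) / n%:R) ^+ n.
Proof.
move=> x0; have := @leif_AGM R 'I_n predT x (fun i _ => x0 i).
by rewrite card_ord => /leifP; case: ifP => _ => [/eqP ->|/ltW].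
Qed.

Lemma posdef_det_le_mean n (A : 'M[C]_n) : posdef A -> Re (\det A) <= (rtr A / n%:R) ^+ n.
Proof.
move=> pA; apply: (le_trans (hadamard_ineq pA)); rewrite /rtr Re_sum.
by apply: prod_le_mean => i; have [_ /ltW] := posdef_diag_gt0 i pA.
Qed.

Lemma chol_unit n (L : 'M[C]_n) (r : 'I_n -> R) :
  is_trig_mx L -> (forall i, L i i = (r i)%:C) -> (forall i, 0 < r i) -> L \in unitmx.
Proof.
move=> tL dL r0; rewrite unitmxE det_trig// unitfE prodf_seq_neq0; apply/allP => i _ /=.
by rewrite dL fmorph_eq0 gt_eqF.
Qed.

Lemma ReM_real (x y : C) : x = (Re x)%:C -> Re (x * y) = Re x * Re y.
Proof. by move=> ->; rewrite ReRM. Qed.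

Lemma posdef_cholesky n (A : 'M[C]_n) : posdef A ->
  exists2 L : 'M[C]_n, L \in unitmx & A = L *m conjT L.
Proof.
by move=> /cholesky[L [r [tL dL r0 ->]]]; exists L => //; exact: chol_unit r0.
Qed.

(** Congruence by the inverse Cholesky factor of [B] sends [B] to the identity and [A] to some [X]
    below it. The diagonal of [X] lies between [0] and [1], so Hadamard's inequality gives
    [\det X <= 1]. *)
Lemma posdef_det_mono n (A B : 'M[C]_n) : posdef A -> posdef B -> psd (B - A) ->
  Re (\det A) <= Re (\det B).
Proof.
move=> pA pB pBA; have [L uL eB] := posdef_cholesky pB.
pose S := conjT (invmx L); pose X := conjT S *m A *m S.
have eS : conjT S = invmx L by rewrite /S conjTK.
have uS : S \in unitmx by rewrite /S conjT_unit unitmx_inv.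
have pX : posdef X by apply: posdef_congr => // y; exact: unitmx_cinj.
have eX : conjT S *m B *m S = 1%:M.
  by rewrite eS eB mulKmx// /S -conjTM mulVmx// conjT1.
have pY : psd (1%:M - X) by rewrite -eX -mulmxBl -mulmxBr; exact: psd_congr.
have X1 : Re (\det X) <= 1.
  apply: (le_trans (hadamard_ineq pX)); apply: prodr_ile1 => i.
  have [_ /ltW -> /=] := posdef_diag_gt0 i pX.
  by have [_] := psd_diag_ge0 i pY; rewrite !mxE eqxx ReD ReN subr_ge0.
have eA : A = L *m X *m conjT L.
  by rewrite /X eS !mulmxA mulmxV// mul1mx -mulmxA /S -conjTM mulmxV// conjT1 mulmx1.
have -> : \det A = \det B * \det X by rewrite eA eB !det_mulmx; ring.
have [eb b0] := posdef_det pB.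
by rewrite (ReM_real _ eb) ler_piMr// ltW.
Qed.

(** [E] is the complementary orthogonal projector, and the lost trace is that of [E *m Q *m E],
    which is nonnegative. *)
Lemma mxtrace_projection_le n k (Q : 'M[C]_n) (U : 'M[C]_(k, n)) :
  psd Q -> U *m conjT U = 1%:M -> rtr (U *m Q *m conjT U) <= rtr Q.
Proof.
move=> pQ hU; pose E := 1%:M - conjT U *m U.
have hE : conjT E = E by rewrite /E conjTB conjT1 conjTM conjTK.
have EE : E *m E = E.
  rewrite /E mulmxBl mul1mx mulmxBr mulmx1 mulmxA -(mulmxA (conjT U)) hU mulmx1.
  by rewrite subrr subr0.
have := rtr_ge0 (psd_congr E pQ); rewrite hE /rtr.
rewrite mxtrace_mulC mulmxA EE /E mulmxBl mul1mx linearB /= ReD ReN.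
have -> : \tr (U *m Q *m conjT U) = \tr (conjT U *m U *m Q).
  by rewrite -mulmxA [LHS]mxtrace_mulC -[in LHS]mulmxA [LHS]mxtrace_mulC.
by rewrite subr_ge0.
Qed.

(** Factoring out the Cholesky factor [L] of [G *m conjT G] leaves [X], whose trace is at most
    [c + rtr Q] since [U] has orthonormal rows; Hadamard's inequality and AM-GM bound its
    determinant. The constant [c] is the trace of the inverse of [G *m conjT G] and does not depend
    on [Q]. *)
Lemma det_le_water n k (G : 'M[C]_(n, k)) : posdef (G *m conjT G) ->
  exists2 c : R, 0 <= c & forall Q : 'M[C]_k, psd Q ->
    posdef (1%:M + G *m Q *m conjT G) /\
    Re (\det (1%:M + G *m Q *m conjT G)) <=
      Re (\det (G *m conjT G)) * ((c + rtr Q) / n%:R) ^+ n.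
Proof.
move=> pW; have [L uL eW] := posdef_cholesky pW.
pose S := conjT (invmx L); pose U := invmx L *m G.
have hU : U *m conjT U = 1%:M.
  rewrite /U conjTM mulmxA -(mulmxA _ G) eW mulKmx// -conjTM mulVmx// conjT1//.
have uS : S \in unitmx by rewrite /S conjT_unit unitmx_inv.
have pS : posdef (conjT S *m S).
  rewrite -[conjT S]mulmx1; apply: posdef_congr; first exact: posdef1.
  by move=> y; exact: unitmx_cinj.
exists (rtr (conjT S *m S)); first by apply/rtr_ge0/psd_mulmx_conjT.
move=> Q pQ.
split; first by apply: posdefD_psd; [exact: posdef1|exact: psd_congrV].
pose X := conjT S *m S + U *m Q *m conjT U.
have pX : posdef X.
  by apply: posdefD_psd; [exact: pS|exact: psd_congrV].
have -> : 1%:M + G *m Q *m conjT G = L *m X *m conjT L.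
  rewrite /X mulmxDr mulmxDl; congr (_ + _).
    by rewrite /S conjTK mulmxA mulmxV// mul1mx -conjTM mulmxV// conjT1.
  rewrite /U conjTM !mulmxA mulmxV// mul1mx -!mulmxA; congr (_ *m (_ *m _)).
  by rewrite -conjTM mulmxV// conjT1 mulmx1.
have -> : \det (L *m X *m conjT L) = \det (G *m conjT G) * \det X.
  by rewrite eW !det_mulmx; ring.
have [ew w0] := posdef_det pW; rewrite (ReM_real _ ew) ler_pM2l//.
apply: (le_trans (posdef_det_le_mean pX)); have [_ X0] := posdef_det pX.
have tX : 0 <= rtr X by apply/rtr_ge0/posdef_psd.
apply: lerXn2r; rewrite ?nnegrE.
- by rewrite divr_ge0// ler0n.
- rewrite divr_ge0 ?ler0n// addr_ge0 ?rtr_ge0//; exact: psd_mulmx_conjT.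
- rewrite ler_wpM2r ?invr_ge0 ?ler0n// /X /rtr linearD /= ReD lerD2l.
  exact: mxtrace_projection_le.
Qed.

Lemma det_scale_le n (W : 'M[C]_n) (a : R) : 0 < a -> posdef W ->
  a ^+ n * Re (\det W) <= Re (\det (1%:M + a%:C *: W)).
Proof.
move=> a0 pW; have -> : a ^+ n * Re (\det W) = Re (\det (a%:C *: W)).
  by rewrite detZ -rmorphXn ReRM.
apply: posdef_det_mono; first exact: posdefZ.
  by apply: posdefD_psd; [exact: posdef1|exact/psdZ/posdef_psd/pW/ltW].
by rewrite addrK; exact: psd1.
Qed.

(* Gram-Schmidt projector onto the orthogonal complement of the span of [s].
   When [a] already lies in the span of [s'], the inverse is [0^-1 = 0] and the
   projector is rightly left unchanged. *)
Fixpoint cproj n (s : seq 'rV[C]_n) : 'M[C]_n :=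
  if s is a :: s' then
    let Q := cproj s' in
    Q - ((Re ((a *m Q *m conjT a) 0 0))^-1)%:C *: (Q *m conjT a *m (a *m Q))
  else 1%:M.

Definition gain n (s : seq 'rV[C]_n) (a : 'rV[C]_n) : R :=
  Re ((a *m cproj s *m conjT a) 0 0).

Lemma cproj_cons n (s : seq 'rV[C]_n) a : cproj (a :: s) =
  cproj s - (gain s a)^-1%:C *: (cproj s *m conjT a *m (a *m cproj s)).
Proof. by []. Qed.

Lemma cproj_herm n (s : seq 'rV[C]_n) : conjT (cproj s) = cproj s.
Proof.
elim: s => [|a s IH]; first exact: conjT1.
by rewrite cproj_cons conjTB conjTZr !conjTM conjTK IH.
Qed.

Lemma gain_real n (s : seq 'rV[C]_n) a : a *m cproj s *m conjT a = (gain s a)%:C%:M.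
Proof.
rewrite [LHS]mx11E; congr (_%:M); apply: conjc_fix_real; rewrite -conjTE.
by rewrite !conjTM conjTK cproj_herm mulmxA.
Qed.

(** Idempotence makes the gain a squared norm; conversely, a zero gain kills the correction term of
    the next step, which settles the case of [0^-1]. Hence a single induction for both. *)
Lemma cproj_idem_gain n (s : seq 'rV[C]_n) :
  cproj s *m cproj s = cproj s /\
  forall a, 0 <= gain s a /\ (gain s a = 0 -> cproj s *m conjT a = 0 /\ a *m cproj s = 0).
Proof.
have aux Q (a : 'rV[C]_n) : conjT Q = Q -> Q *m Q = Q ->
    Re ((a *m Q *m conjT a) 0 0) = Re ((conjT (Q *m conjT a) *m (Q *m conjT a)) 0 0).
  by move=> hQ QQ; rewrite conjTM conjTK hQ mulmxA -(mulmxA a Q Q) QQ.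
have fin (s' : seq 'rV[C]_n) : cproj s' *m cproj s' = cproj s' ->
  forall a, 0 <= gain s' a /\ (gain s' a = 0 -> cproj s' *m conjT a = 0 /\ a *m cproj s' = 0).
  move=> QQ a; rewrite /gain (aux _ _ (cproj_herm s') QQ).
  split; [exact: normsq_ge0|move/normsq_eq0 => h].
  by split=> //; rewrite -[LHS]conjTK conjTM cproj_herm h conjT0.
elim: s => [|a s [QQ IH]]; first by split; [exact: mulmx1|apply: fin; exact: mulmx1].
suff h : cproj (a :: s) *m cproj (a :: s) = cproj (a :: s) by split=> //; exact: fin.
have [g0 gz] := IH a; have [g1|gn0] := eqVneq (gain s a) 0.
  by rewrite cproj_cons; have [-> ->] := gz g1; rewrite mul0mx scaler0 subr0.
rewrite cproj_cons; set Q := cproj s; set g := gain s a; set k := _%:C.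
have gC : g%:C != 0 :> C by rewrite fmorph_eq0.
pose u := Q *m conjT a; pose v := a *m Q.
have Qu : Q *m u = u by rewrite /u mulmxA QQ.
have vQ : v *m Q = v by rewrite /v -mulmxA QQ.
have vu : v *m u = g%:C%:M by rewrite /u mulmxA vQ; exact: gain_real.
rewrite -/u -/v mulmxBl mulmxBr QQ -scalemxAr mulmxA Qu mulmxBr -!scalemxAl -!scalemxAr.
rewrite -(mulmxA u v Q) vQ (mulmxA (u *m v) u v) -(mulmxA u v u) vu mul_mx_scalar -scalemxAl.
have kg : k * g%:C = 1 by rewrite /k fmorphV mulVf.
by rewrite (scalerA k g%:C) kg scale1r subrr subr0.
Qed.

Lemma cproj_idem n (s : seq 'rV[C]_n) : cproj s *m cproj s = cproj s.
Proof. by have [] := cproj_idem_gain s. Qed.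
Lemma gain_ge0 n (s : seq 'rV[C]_n) a : 0 <= gain s a.
Proof. by have [_ /(_ a)[]] := cproj_idem_gain s. Qed.
Lemma gain_eq0 n (s : seq 'rV[C]_n) a : gain s a = 0 -> a *m cproj s = 0.
Proof. by have [_ /(_ a)[_ h] /h[]] := cproj_idem_gain s. Qed.

Lemma cproj_ker n (s : seq 'rV[C]_n) b : b \in s -> b *m cproj s = 0.
Proof.
elim: s => // a s IH; rewrite inE cproj_cons mulmxBr -scalemxAr !mulmxA.
case/orP => [/eqP ->|/IH ->]; last by rewrite !mul0mx scaler0 subr0.
have [g0|g0] := eqVneq (gain s a) 0.
  by rewrite (gain_eq0 g0) !mul0mx scaler0 subr0.
rewrite gain_real mul_scalar_mx -scalemxAl scalerA -rmorphM mulVf//.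
by rewrite scale1r subrr.
Qed.

Lemma cproj_span m n (H : 'M[C]_(m, n)) (s : seq 'I_m) (x : 'rV[C]_n) :
  exists2 c : 'rV[C]_m, forall i, i \notin s -> c 0 i = 0 &
    x - x *m cproj [seq row i H | i <- s] = c *m H.
Proof.
elim: s x => [|a s IH] x.
  by exists 0 => [i|]; rewrite ?mxE// mulmx1 subrr mul0mx.
rewrite /= -/(gain _ _); set P := cproj _; set g := gain _ _.
have [c1 c1z e1] := IH x; have [c2 c2z e2] := IH (row a H).
pose k := g^-1%:C * (x *m P *m conjT (row a H)) 0 0.
(* The projected row [row a H *m P] has coefficients [delta_mx 0 a - c2], and the new projector
   subtracts [k] times that row. *)
exists (c1 + k *: (delta_mx 0 a - c2)) => [i|].
  rewrite inE negb_or => /andP[ia ins].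
  by rewrite !mxE (c1z _ ins) (c2z _ ins) eqxx /= (negbTE ia) subr0 mulr0 addr0.
rewrite mulmxBr opprB addrCA [RHS]mulmxDl -e1 [RHS]addrC; congr (_ + _).
rewrite -scalemxAr -scalemxAl mulmxBl -rowE -e2 opprB addrC subrK.
by rewrite !mulmxA [x *m P *m _]mx11E mul_scalar_mx -scalemxAl scalerA.
Qed.

(** The difference is the squared modulus of [b *m cproj s *m conjT a] over [gain s b]. *)
Lemma gain_cons n (s : seq 'rV[C]_n) b a :
  gain (b :: s) a <= gain s a.
Proof.
rewrite {1}/gain cproj_cons mulmxBr mulmxBl mxE ReD -/(gain s a) gerDl mxE ReN oppr_le0.
rewrite -scalemxAr -scalemxAl mxE ReRM mulr_ge0 ?invr_ge0 ?gain_ge0//.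
have -> : a *m (cproj s *m conjT b *m (b *m cproj s)) *m conjT a =
    conjT (b *m cproj s *m conjT a) *m (b *m cproj s *m conjT a).
  by rewrite !conjTM !conjTK cproj_herm !mulmxA.
exact: normsq_ge0.
Qed.

(** Linear independence of [s] in Gram-Schmidt form: no vector lies in the span of those behind
    it. *)
Fixpoint pivots n (s : seq 'rV[C]_n) : Prop :=
  if s is a :: s' then gain s' a != 0 /\ pivots s' else True.

(** For independent [s] the projector has rank [n - size s], the multiplicity of the eigenvalue
    [1 + t]; the power on the left avoids a truncated subtraction. Each vector of [s] contributes a
    rank-one factor. *)
Lemma det_cproj n (s : seq 'rV[C]_n) (t : R) : -1 < t -> pivots s ->
  \det (1%:M + t%:C *: cproj s) * (1 + t)%:C ^+ size s = (1 + t)%:C ^+ n.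
Proof.
move=> t1; have t0 : 1 + t != 0 by rewrite gt_eqF// -ltrBlDl sub0r.
have tC0 : (1 + t)%:C != 0 :> C by rewrite fmorph_eq0.
elim: s => [_|a s IH [g0 ps]].
  rewrite expr0 mulr1 /= -[in LHS](scale1r 1%:M) scalerA mulr1 -scalerDl.
  by rewrite detZ det1 mulr1 rmorphD rmorph1.
rewrite cproj_cons; set Q := cproj s; set g := gain s a.
(* [k] solves [(1 + t Q) (1 - k u v) = 1 + t (Q - u v / g)], given [Q u = u]; the second factor has
   determinant [1 - k g = (1 + t)^-1]. *)
pose u := Q *m conjT a; pose v := a *m Q; pose k := (t / (1 + t) / g)%:C.
have Qu : Q *m u = u by rewrite /u mulmxA cproj_idem.
have vu : v *m u = g%:C%:M by rewrite /u mulmxA -(mulmxA a) cproj_idem gain_real.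
have -> : 1%:M + t%:C *: (Q - g^-1%:C *: (u *m v)) =
    (1%:M + t%:C *: Q) *m (1%:M + (- k *: u) *m v).
  rewrite mulmxDr mulmx1 -addrA; congr (_ + _).
  rewrite mulmxDl mul1mx -!scalemxAl -!scalemxAr (mulmxA Q u v) Qu scalerBr; congr (_ + _).
  rewrite !scalerA -scalerDl -scaleNr; congr (_ *: _); rewrite -!rmorphM -!rmorphN -!rmorphM -rmorphD.
  by congr (_%:C); field; rewrite t0 g0.
rewrite det_mulmx det_mulmx_one_addC -scalemxAr vu scale_scalar_mx scalar_mxDE det_scalar1.
have kx : (1 + - k * g%:C) * (1 + t)%:C = 1.
  rewrite -rmorphN -rmorphM -(rmorph1 (real_complex R)) -rmorphD -rmorphM.
  by congr (_%:C); field; rewrite t0 g0.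
rewrite -(IH ps) -/Q [size _]/= exprS; set D := \det _; set y := _ ^+ size s.
by transitivity (D * y * ((1 + - k * g%:C) * (1 + t)%:C)); [ring|rewrite kx mulr1].
Qed.

Lemma cproj_psd n (s : seq 'rV[C]_n) : psd (cproj s).
Proof.
rewrite -cproj_idem -{1}cproj_herm; exact: psd_mulmx_conjT.
Qed.

Lemma cprojC_psd n (s : seq 'rV[C]_n) : psd (1%:M - cproj s).
Proof.
have -> : 1%:M - cproj s = conjT (1%:M - cproj s) *m (1%:M - cproj s).
  rewrite conjTB conjT1 cproj_herm mulmxBl mul1mx mulmxBr mulmx1 cproj_idem.
  by rewrite subrr subr0.
exact: psd_mulmx_conjT.
Qed.

Lemma posdef_one_cproj n (s : seq 'rV[C]_n) (t : R) : -1 < t ->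
  posdef (1%:M + t%:C *: cproj s).
Proof.
move=> t1; have [t0|t0] := leP 0 t.
  by apply: posdefD_psd; [exact: posdef1|apply: psdZ => //; exact: cproj_psd].
have -> : 1%:M + t%:C *: cproj s =
    (1 + t)%:C *: 1%:M + (- t)%:C *: (1%:M - cproj s).
  rewrite scalerBr rmorphD rmorph1 rmorphN scalerDl scale1r !scaleNr opprK.
  by rewrite addrA addrK.
apply: posdefD_psd; first by apply: posdefZ; [lra|exact: posdef1].
by apply: psdZ; [lra|exact: cprojC_psd].
Qed.

Fixpoint vol n (s r : seq 'rV[C]_n) : R :=
  if r is a :: r' then gain s a * vol (a :: s) r' else 1.

(** The Schur complement of the first row is one Gram-Schmidt step: it replaces [cproj s] by
    [cproj (a :: s)]. With a zero pivot both sides vanish. *)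
Lemma det_cproj_gram k n (A : 'M[C]_(k, n)) (s : seq 'rV[C]_n) :
  \det (A *m cproj s *m conjT A) = (vol s [seq row i A | i <- enum 'I_k])%:C.
Proof.
elim: k A s => [|k IH]; last rewrite -[k.+1]/(1 + k)%N; move=> A s.
  by rewrite det_mx00 (_ : enum 'I_0 = [::])//; apply: size0nil; rewrite size_enum_ord.
rewrite [enum _]enum_ordSl /=.
rewrite [row ord0 A](_ : _ = usubmx A); last first.
  by apply/rowP => j; rewrite !mxE; congr (A _ _); apply/val_inj.
rewrite -map_comp (eq_map (g := fun i => row i (dsubmx A))); last first.
  by move=> i /=; apply/rowP => j; rewrite !mxE; congr (A _ _); apply/val_inj.
set a := usubmx A; set B := dsubmx A; rewrite realCM -IH.
rewrite -(vsubmxK A) -/a -/B conjT_col_mx mul_col_mx mul_col_row gain_real.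
have [g0|g0] := eqVneq (gain s a) 0.
  rewrite -(mulmxA B); have -> : cproj s *m conjT a = 0.
    by rewrite -[LHS]conjTK conjTM conjTK cproj_herm gain_eq0// conjT0.
  rewrite (gain_eq0 g0) g0 rmorph0 mul0mx mul0r mulmx0.
  by rewrite det_lblock det_mx11 mxE mul0r.
rewrite det_schur ?fmorph_eq0//; congr (_ * \det _).
rewrite cproj_cons mulmxBr mulmxBl; congr (_ - _).
by rewrite -scalemxAr -scalemxAl fmorphV !mulmxA.
Qed.

Lemma cproj_fix n k (s : seq 'rV[C]_n) (X : 'M[C]_(n, k)) :
  (forall b, b \in s -> b *m X = 0) -> cproj s *m X = X.
Proof.
elim: s => [|a s IH] h; first exact: mul1mx.
have QX : cproj s *m X = X by apply: IH => b bs; apply: h; rewrite inE bs orbT.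
rewrite cproj_cons mulmxBl -scalemxAl -!mulmxA QX h ?mem_head//.
by rewrite !mulmx0 scaler0 subr0.
Qed.

(** Orthonormalizing a row base of the projector gives some number [r] of columns; the determinant
    of [1 + cproj s], computed in two ways, forces [2 ^ (r + size s) = 2 ^ n]. The exact width
    matters because [bd_dim] prescribes it. *)
Lemma cproj_split n (s : seq 'rV[C]_n) : pivots s -> (size s <= n)%N ->
  exists V : 'M[C]_(n, n - size s), conjT V *m V = 1%:M /\ V *m conjT V = cproj s.
Proof.
move=> ps sn; pose P := cproj s.
suff [r [V [h1 h2]]] : exists r (V : 'M[C]_(n, r)), conjT V *m V = 1%:M /\ V *m conjT V = P.
  suff <- : r = (n - size s)%N by exists V.
  have := @det_cproj _ s 1 _ ps; rewrite -/P -h2 rmorph1 scale1r det_mulmx_one_addC h1.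
  have e1 : (1 + 1)%:C = 2%:R :> C by rewrite -mulr2n rmorph_nat.
  have e0 : 1 + 1 = 2%:R :> C by rewrite -mulr2n.
  rewrite scalar_mxDE det_scalar e0 e1 -exprD => e.
  have {}e : (2 ^ (r + size s))%:R = (2 ^ n)%:R :> C by rewrite !natrX; apply: e; lra.
  move: e => /eqP; rewrite eqr_nat eqn_exp2l// => /eqP e; lia.
pose B := row_base P.
have [Y eP] : exists Y, P = Y *m B by apply/submxP; rewrite eq_row_base.
have [Z eB] : exists Z, B = Z *m P by apply/submxP; rewrite eq_row_base.
have pW : posdef (B *m conjT B).
  have := @posdef_congr _ _ 1%:M (conjT B) (posdef1 _); rewrite conjTK mulmx1; apply.
  move=> y /(congr1 (@conjT R _ _)); rewrite conjTM conjTK conjT0 => yB.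
  rewrite -[y]conjTK; suff -> : conjT y = 0 by rewrite conjT0.
  by apply: (row_free_inj (row_base_free P)); rewrite mul0mx.
have [L uL eW] := posdef_cholesky pW.
pose U := invmx L *m B; exists (\rank P), (conjT U); rewrite conjTK.
have UU : U *m conjT U = 1%:M.
  by rewrite /U conjTM mulmxA -(mulmxA _ B) eW mulKmx// -conjTM mulVmx// conjT1.
split=> //.
have UP : U *m P = U by rewrite /U eB !mulmxA -(mulmxA _ P) cproj_idem.
have PU : P *m (conjT U *m U) = P.
  have eP2 : P = Y *m L *m U by rewrite /U -mulmxA mulKVmx.
  by rewrite [X in X *m _]eP2 -(mulmxA _ U) (mulmxA U) UU mul1mx -eP2.
have : conjT (P *m (conjT U *m U)) = conjT P by rewrite PU.
have hP : conjT P = P by exact: cproj_herm.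
by rewrite (conjTM P) (conjTM (conjT U)) conjTK hP -mulmxA UP.
Qed.

End HermitianMatrices.

(** * High-power behaviour of the capacities *)

Section Capacity.
Variable R : realType.
Local Notation C := (R[i]).
Local Notation Re := (@complex.Re R).
Local Notation Im := (@complex.Im R).
Local Notation "x %:C" := (real_complex R x).

Lemma innerE n (u v : 'rV[C]_n) : inner u v = (u *m conjT v) 0 0.
Proof. by rewrite mxE; apply: eq_bigr => l _; rewrite conjTE. Qed.

(** [zf_proj] is picked by choice, so uniqueness is the point: two admissible projections differ by
    a combination of the other rows that is orthogonal to all of them, hence by zero. *)
Lemma zf_gain2E m n (H : 'M[C]_(m, n)) i (s : seq 'I_m) :
  (forall j, (j \in s) = (j != i)) ->
  zf_gain2 H i = gain [seq row j H | j <- s] (row i H).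
Proof.
move=> hs; set rs := [seq row j H | j <- s].
pose p0 := row i H *m cproj rs.
have Pk j : j != i -> cproj rs *m conjT (row j H) = 0.
  move=> ji; rewrite -[LHS]conjTK conjTM conjTK cproj_herm cproj_ker ?conjT0//.
  by apply: map_f; rewrite hs.
have hp0 : is_zf_proj H i p0.
  split=> [j ji|].
    by rewrite innerE -mulmxA Pk// mulmx0 mxE.
  have [c cz e] := cproj_span H s (row i H); exists (c 0).
  rewrite e; apply/rowP => l; rewrite mxE summxE (bigD1 i)//= cz ?hs ?eqxx// mul0r add0r.
  by apply: eq_bigr => j _; rewrite !mxE.
rewrite /zf_gain2 /zf_proj; case: pselect => [ex|[]]; last by exists p0.
case: (cid ex) => p [hp [c hc]] /=.
suff -> : p = p0.
  by rewrite /vnorm2 innerE /gain /p0 conjTM cproj_herm mulmxA -(mulmxA (row i H)) cproj_idem.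
have [hq [c' hc']] := hp0.
have e : p - p0 = \sum_(j < m | j != i) (c' j - c j) *: row j H.
  under eq_bigr do rewrite scalerBl.
  by rewrite sumrB -hc -hc' opprB [RHS]addrC [RHS]addrA subrK.
have orth j : j != i -> (p - p0) *m conjT (row j H) = 0.
  move=> ji; have := hp j ji; have := hq j ji; rewrite !innerE => h2 h1.
  apply/matrixP => x y; rewrite (ord1 x) (ord1 y) mulmxBl [LHS]mxE [X in _ + X]mxE h1 h2.
  by rewrite subrr mxE.
have : conjT (conjT (p - p0)) *m conjT (p - p0) = 0.
  rewrite conjTK {2}e conjT_sum mulmx_sumr big1// => j ji.
  by rewrite conjTZ -scalemxAr orth// scaler0.
move=> h0; have /normsq_eq0 : Re ((conjT (conjT (p - p0)) *m conjT (p - p0)) 0 0) = 0.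
  by rewrite h0 mxE.
move=> /(congr1 (@conjT R _ _)).
by rewrite conjTK conjT0 => /eqP; rewrite subr_eq0 => /eqP.
Qed.

(* Selector of the rows of user [k]. *)
Definition usel K N (k : 'I_K) : 'M[C]_(N, K * N) := user_ch 1%:M k.

Lemma mul_usel K N n (k : 'I_K) (X : 'M[C]_(K * N, n)) : @usel K N k *m X = user_ch X k.
Proof.
apply/matrixP => i j; rewrite !mxE (bigD1 (mxvec_index k i))//= !mxE eqxx mul1r big1 ?addr0//.
by move=> l li; rewrite !mxE eq_sym (negbTE li) mul0r.
Qed.

Lemma mxvec_index_inj K N (k k' : 'I_K) (n n' : 'I_N) :
  (mxvec_index k n == mxvec_index k' n') = (k == k') && (n == n').
Proof.
apply/eqP/andP => [|[/eqP -> /eqP ->]//]; rewrite /mxvec_index => /cast_ord_inj/enum_rank_inj[-> ->].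
by rewrite !eqxx.
Qed.

Lemma usel_ortho K N (k : 'I_K) : @usel K N k *m conjT (usel N k) = 1%:M.
Proof.
apply/matrixP => i j; rewrite mul_usel !mxE mxvec_index_inj eqxx /= eq_sym.
by rewrite rmorph_nat.
Qed.

Lemma sum_mxvec_index (V : zmodType) K N (F : 'I_(K * N) -> V) :
  \sum_a F a = \sum_(k < K) \sum_(n < N) F (mxvec_index k n).
Proof.
rewrite pair_big /= (reindex (uncurry (@mxvec_index K N))).
  by apply: eq_bigr => -[].
exact: curry_mxvec_bij.
Qed.

Lemma sum_usel K N : \sum_k conjT (usel N k) *m usel N k = 1%:M :> 'M[C]_(K * N).
Proof.
apply/matrixP => a b; rewrite summxE mxE.
transitivity (\sum_(k < K) \sum_(n < N)
   (((mxvec_index k n == a)%:R : C) * (mxvec_index k n == b)%:R)).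
  by apply: eq_bigr => k _; rewrite mxE; apply: eq_bigr => n _; rewrite !mxE rmorph_nat.
rewrite -(sum_mxvec_index (fun c => ((c == a)%:R : C) * (c == b)%:R)) (bigD1 a)//= eqxx mul1r.
by rewrite big1 ?addr0// => c /negbTE ->; rewrite mul0r.
Qed.

(** The basis [V] is picked by choice, but the Gram matrix depends on it only through
    [V *m conjT V], the orthogonal projector onto the null space of the other users. *)
Lemma bd_gram K N M (H : 'M[C]_(K * N, M)) k (s : seq 'I_(K * N)) :
  (forall j n, (mxvec_index j n \in s) = (j != k)) ->
  pivots [seq row j H | j <- s] -> size s = ((K - 1) * N)%N -> (size s <= M)%N ->
  bd_G H k *m conjT (bd_G H k) =
  user_ch H k *m cproj [seq row j H | j <- s] *m conjT (user_ch H k).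
Proof.
move=> hs ps zs sM; set rs := [seq row j H | j <- s].
have zrs : size rs = ((K - 1) * N)%N by rewrite size_map.
have inS j n : j != k -> row n (user_ch H j) \in rs.
  move=> jk; rewrite (_ : row n _ = row (mxvec_index j n) H); last by apply/rowP => l; rewrite !mxE.
  by apply: map_f; rewrite hs.
have zeroE p (X : 'M[C]_(M, p)) : (forall j, j != k -> user_ch H j *m X = 0) ->
    cproj rs *m X = X.
  move=> hX; apply: cproj_fix => b /mapP[a as_ ->]; case/mxvec_indexP: a as_ => j n.
  rewrite hs => jk; apply/rowP => l; have := hX _ jk => /matrixP/(_ n l) e.
  rewrite [RHS]mxE; transitivity ((user_ch H j *m X) n l); last by rewrite e mxE.
  by rewrite !mxE; apply: eq_bigr => q _; rewrite !mxE.
have userP j : j != k -> user_ch H j *m cproj rs = 0.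
  by move=> jk; apply/row_matrixP => n; rewrite row_mul row0 cproj_ker// inS.
have exV : exists V, @bd_ok R K N M H k (bd_dim K N M) V.
  have [] := cproj_split ps; first by rewrite zrs -zs.
  rewrite zrs -/(bd_dim K N M) => V [VV PV]; exists V; split=> //; split=> [j jk|x hx].
    by rewrite -[V]mulmx1 -VV mulmxA mulmxA -(mulmxA _ V) PV userP// mul0mx.
  by exists (conjT V *m x); rewrite mulmxA PV zeroE.
rewrite /bd_G /bd_basis; case: pselect => // ex; case: (cid ex) => V [VV [HV nV]] /=.
suff PV : V *m conjT V = cproj rs.
  by rewrite conjTM mulmxA -(mulmxA _ V) PV.
(* Each column of [cproj rs] is annihilated by the other users, hence lies in the range of [V] and
   is fixed by [V *m conjT V]. *)
have e1 : V *m conjT V *m cproj rs = cproj rs.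
  apply/matrixP => a b; have [|y hy] := nV (col b (cproj rs)).
    move=> j jk; apply/matrixP => n l; have := userP _ jk => /matrixP/(_ n b).
    move=> e; rewrite [RHS]mxE; transitivity ((user_ch H j *m cproj rs) n b).
      by rewrite !mxE; apply: eq_bigr => q _; rewrite !mxE.
    by rewrite e mxE.
  have : V *m conjT V *m col b (cproj rs) = col b (cproj rs).
    by rewrite hy -mulmxA (mulmxA _ V) VV mul1mx.
  by rewrite colE mulmxA -!colE => /matrixP/(_ a 0); rewrite ![col _ _ _ _]mxE.
have e2 : cproj rs *m V = V by exact: zeroE.
rewrite -e1 -mulmxA; congr (_ *m _).
by rewrite -[RHS]conjTK conjTM conjTK cproj_herm e2.
Qed.

Lemma bd_gram_det K N M (H : 'M[C]_(K * N, M)) k (s : seq 'I_(K * N)) :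
  (forall j n, (mxvec_index j n \in s) = (j != k)) ->
  pivots [seq row j H | j <- s] -> size s = ((K - 1) * N)%N -> (size s <= M)%N ->
  \det (bd_G H k *m conjT (bd_G H k)) =
  (vol [seq row j H | j <- s] [seq row (mxvec_index k n) H | n <- enum 'I_N])%:C.
Proof.
move=> hs ps zs sM; rewrite (bd_gram hs)// det_cproj_gram; congr (vol _ _)%:C.
by apply: eq_map => n; apply/rowP => j; rewrite !mxE.
Qed.

(** * Growth of the capacities with the power *)

Lemma ln2_gt0 : 0 < ln 2 :> R.
Proof. by rewrite ln_gt0// ltr1n. Qed.

Lemma log2M (x y : R) : 0 < x -> 0 < y -> log2 (x * y) = log2 x + log2 y.
Proof. by move=> x0 y0; rewrite /log2 lnM ?posrE// mulrDl. Qed.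
Lemma log2X (x : R) n : 0 < x -> log2 (x ^+ n) = n%:R * log2 x.
Proof. by move=> x0; rewrite /log2 lnXn// mulr_natl mulrnAl. Qed.
Lemma ler_log2 (x y : R) : 0 < x -> x <= y -> log2 x <= log2 y.
Proof.
move=> x0 xy; rewrite /log2; apply: ler_wpM2r; first by rewrite invr_ge0 ltW// ln2_gt0.
by rewrite ler_ln ?posrE// (lt_le_trans x0).
Qed.
Lemma log2_prod (I : finType) (F : I -> R) : (forall i, 0 < F i) ->
  log2 (\prod_i F i) = \sum_i log2 (F i).
Proof.
move=> F0.
suff [_ ->] : 0 < \prod_i F i /\ log2 (\prod_i F i) = \sum_i log2 (F i) by [].
apply: (big_ind2 (fun x y => 0 < x /\ log2 x = y)) => [|x1 x2 y1 y2 [x0 <-] [y0 <-]|i _] //.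
- by split=> //; rewrite /log2 ln1 mul0r.
- by split; [exact: mulr_gt0|exact: log2M].
Qed.

Lemma sup_between (S : set R) l u : (exists2 x, S x & l <= x) -> (forall x, S x -> x <= u) ->
  l <= sup S <= u.
Proof.
move=> [x Sx lx] Su; have hS : has_sup S by split; [exists x|exists u => y; exact: Su].
apply/andP; split.
  by apply: (le_trans lx); apply: ub_le_sup => //; case: hS.
by apply: ge_sup; [exists x|move=> y; exact: Su].
Qed.

(* The lower bound comes from an isotropic power allocation, the upper bound from
   Hadamard's inequality and AM-GM. *)
Definition capacity_growth (f : R -> R) (m : nat) (D : R) : Prop :=
  0 < D /\ exists2 c : R, 0 <= c & forall P, 0 < P ->
    log2 (D * (P / m%:R) ^+ m) <= f P <= log2 (D * ((c + P) / m%:R) ^+ m).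

(** The two bounds differ by [m * log2 (1 + c / P)], which is at most [m * c / (ln 2 * P)] and so
    vanishes in the limit. *)
Lemma capacity_growth_cvg (f : R -> R) m D : (0 < m)%N -> capacity_growth f m D ->
  f P - m%:R * log2 (P / m%:R) @[P --> +oo] --> log2 D.
Proof.
move=> m0 [D0 [c c0 h]]; have mR : 0 < m%:R :> R by rewrite ltr0n.
have logE x : 0 < x -> log2 (D * x ^+ m) = log2 D + m%:R * log2 x.
  by move=> x0; rewrite log2M ?exprn_gt0// log2X.
apply: (@squeeze_cvgr _ _ _ _ (fun=> log2 D) (fun P => log2 D + m%:R * c / ln 2 * P^-1)).
- near=> P; have P0 : 0 < P by near: P; exact: nbhs_pinfty_gt.
  have Pm : 0 < P / m%:R by rewrite divr_gt0.
  have cPm : 0 < (c + P) / m%:R by rewrite divr_gt0// ltr_wpDl.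
  have := h P P0; rewrite !logE// => /andP[h1 h2].
  rewrite lerBrDr h1/= lerBlDr; apply: (le_trans h2); rewrite -addrA lerD2l.
  have -> : (c + P) / m%:R = (P / m%:R) * (1 + c / P).
    by field; rewrite !gt_eqF.
  have cP0 : 0 <= c / P by rewrite divr_ge0// ltW.
  have -> : log2 (P / m%:R * (1 + c / P)) = log2 (P / m%:R) + log2 (1 + c / P).
    by apply: log2M => //; rewrite ltr_pwDl.
  rewrite mulrDr [leLHS]addrC lerD2r /log2.
  have -> : m%:R * c / ln 2 / P = m%:R * (c / P / ln 2).
    by field; rewrite !gt_eqF// ln2_gt0.
  rewrite ler_pM2l// ler_pM2r ?invr_gt0 ?ln2_gt0//.
  by apply: le_ln1Dx; rewrite (lt_le_trans _ cP0)// ltrN10.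
- exact: cvg_cst.
- rewrite -[X in _ --> X]addr0; apply: cvgD; first exact: cvg_cst.
  rewrite -[X in _ --> X](mulr0 (m%:R * c / ln 2)); apply: cvgM; first exact: cvg_cst.
  apply/gtr0_cvgV0; last exact: cvg_id.
  exact: nbhs_pinfty_gt.
Unshelve. all: by end_near. Qed.

Lemma capacity_gap (f g : R -> R) m D E : (0 < m)%N ->
  capacity_growth f m D -> capacity_growth g m E ->
  lim ((fun P : R => f P - g P) x @[x --> +oo]) = log2 D - log2 E.
Proof.
move=> m0 hf hg; apply: cvg_lim => //.
rewrite (_ : (fun P => _) = (fun P => (f P - m%:R * log2 (P / m%:R)) -
   (g P - m%:R * log2 (P / m%:R)))); last by apply/funext => P; lra.
by apply: cvgB; apply: capacity_growth_cvg.
Qed.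

Lemma prod_add_le_mean n (x : 'I_n -> R) (S : R) : (0 < n)%N -> (forall i, 0 <= x i) ->
  \sum_i x i <= S -> \prod_i x i <= (S / n%:R) ^+ n.
Proof.
move=> n0 x0 xS; apply: (le_trans (prod_le_mean x0)); apply: lerXn2r.
- by rewrite nnegrE divr_ge0 ?ler0n// sumr_ge0.
- by rewrite nnegrE divr_ge0 ?ler0n// (le_trans _ xS)// sumr_ge0.
- by rewrite ler_pM2r// invr_gt0 ltr0n.
Qed.

Lemma sum_const_div n (P : R) : (0 < n)%N -> \sum_(i < n) P / n%:R = P.
Proof.
move=> n0; rewrite sumr_const card_ord -[_ *+ n]mulr_natr divfK// pnatr_eq0 -lt0n//.
Qed.

Lemma C_ZF_growth m n (H : 'M[C]_(m, n)) : (0 < m)%N -> (forall i, 0 < zf_gain2 H i) ->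
  capacity_growth (C_ZF H) m (\prod_i zf_gain2 H i).
Proof.
move=> m0 g0; set g := zf_gain2 H; split; first by apply: prodr_gt0 => i _; exact: g0.
(* This constant comes from [1 + p g = g (g^-1 + p)], with AM-GM applied to the second factors. *)
exists (\sum_i (g i)^-1); first by apply: sumr_ge0 => i _; rewrite invr_ge0 ltW// g0.
move=> P P0; have mR : 0 < m%:R :> R by rewrite ltr0n.
have Pm : 0 < P / m%:R by rewrite divr_gt0.
apply: sup_between.
  eexists; first by exists (fun=> P / m%:R); split; [by move=> i; exact: ltW|split; last reflexivity];
    rewrite sum_const_div.
  rewrite -log2_prod => [|i]; last by rewrite ltr_pwDl// mulr_ge0// ltW// g0.
  apply: ler_log2; first by rewrite mulr_gt0 ?exprn_gt0// prodr_gt0// => i _; exact: g0.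
  rewrite mulrC.
  have -> : (P / m%:R) ^+ m = \prod_(i < m) (P / m%:R) by rewrite prodr_const card_ord.
  rewrite -big_split /=; apply: ler_prod => i _; apply/andP; split; last by rewrite lerDr.
  by apply: mulr_ge0; apply: ltW => //; exact: g0.
move=> _ [Pw [Pw0 [PwP ->]]].
have f0 i : 0 < 1 + Pw i * g i by rewrite ltr_pwDl// mulr_ge0// ltW// g0.
rewrite -log2_prod//; apply: ler_log2; first by apply: prodr_gt0.
have -> : \prod_i (1 + Pw i * g i) = \prod_i g i * \prod_i ((g i)^-1 + Pw i).
  rewrite -big_split; apply: eq_bigr => i _ /=.
  by rewrite mulrDr divff ?gt_eqF ?g0// mulrC.
rewrite ler_pM2l; last by apply: prodr_gt0 => i _; exact: g0.
apply: prod_add_le_mean => //.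
  by move=> i; rewrite addr_ge0// invr_ge0 ltW// g0.
by rewrite big_split /= lerD2l.
Qed.

Lemma mulmx_gram_proj n p (G : 'M[C]_(n, p)) : G *m conjT G \in unitmx ->
  G *m (conjT G *m invmx (G *m conjT G) *m G) *m conjT G = G *m conjT G.
Proof.
move=> uW; transitivity (G *m conjT G *m (invmx (G *m conjT G) *m (G *m conjT G))).
  by rewrite !mulmxA.
by rewrite mulKVmx.
Qed.

Lemma mxtrace_gram_proj n p (G : 'M[C]_(n, p)) : G *m conjT G \in unitmx ->
  \tr (conjT G *m invmx (G *m conjT G) *m G) = n%:R.
Proof. by move=> uW; rewrite mxtrace_mulC mulmxA mulmxV// mxtrace1. Qed.

Lemma C_BD_growth K N M (H : 'M[C]_(K * N, M)) : (0 < K)%N -> (0 < N)%N ->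
  (forall k, posdef (bd_G H k *m conjT (bd_G H k))) ->
  capacity_growth (C_BD H) (K * N) (\prod_k Re (\det (bd_G H k *m conjT (bd_G H k)))).
Proof.
move=> K0 N0 pW; pose W k := bd_G H k *m conjT (bd_G H k).
have dW k : 0 < Re (\det (W k)) by have [] := posdef_det (pW k).
split; first by apply: prodr_gt0 => k _; exact: dW.
have /choice[c hc] : forall k, exists c : R, 0 <= c /\
    forall Q : 'M[C]_(bd_dim K N M), psd Q ->
    posdef (1%:M + bd_G H k *m Q *m conjT (bd_G H k)) /\
    Re (\det (1%:M + bd_G H k *m Q *m conjT (bd_G H k))) <=
      Re (\det (W k)) * ((c + rtr Q) / N%:R) ^+ N.
  by move=> k; have [c c0 h] := det_le_water (pW k); exists c.
have KR : 0 < K%:R :> R by rewrite ltr0n.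
have NR : 0 < N%:R :> R by rewrite ltr0n.
exists (\sum_k c k); first by apply: sumr_ge0 => k _; have [] := hc k.
move=> P P0; have Pm : 0 < P / (K * N)%:R by rewrite divr_gt0// ltr0n muln_gt0 K0.
apply: sup_between.
  (* [E k] is the orthogonal projector onto the row space of [bd_G H k]. Its trace is [N], so each
     user spends [P / K], and it is invisible between [bd_G H k] and its adjoint. *)
  pose E k := conjT (bd_G H k) *m invmx (W k) *m bd_G H k.
  have hE k : psd (E k).
    have hW : conjT (W k) = W k := (pW k).1.
    have uW : W k \in unitmx := posdef_unit (pW k).
    apply: psd_congr; split; first by rewrite conjT_inv// hW.
    move=> x; have [_ pos] := posdef_psd (pW k).
    have := pos (invmx (W k) *m x); rewrite -/(W k) conjTM conjT_inv// hW.
    rewrite -(mulmxA (conjT x *m invmx (W k)) (W k) (invmx (W k) *m x)).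
    by rewrite mulKVmx// mulmxA.
  have GE k : bd_G H k *m E k *m conjT (bd_G H k) = W k.
    by rewrite /E /W; apply: mulmx_gram_proj; exact: posdef_unit.
  have tE k : rtr (E k) = N%:R.
    rewrite /rtr /E /W mxtrace_gram_proj; last exact: posdef_unit.
    by rewrite -(rmorph_nat (real_complex R)).
  eexists; first exists (fun k => (P / (K * N)%:R)%:C *: E k); [split; last split; last reflexivity|].
  - by move=> k; apply: psdZ; [exact: ltW|exact: hE].
  - rewrite (eq_bigr (fun=> P / (K * N)%:R * N%:R)) => [|k _].
      rewrite sumr_const card_ord -[_ *+ K]mulr_natr natrM.
      by rewrite [leLHS](_ : _ = P)//; field; rewrite !gt_eqF.
    by rewrite /rtr mxtraceZ ReRM; congr (_ * _); exact: tE.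
  have eqG k : 1%:M + bd_G H k *m ((P / (K * N)%:R)%:C *: E k) *m conjT (bd_G H k) =
      1%:M + (P / (K * N)%:R)%:C *: W k.
    by rewrite -scalemxAr -scalemxAl GE.
  rewrite [leRHS](eq_bigr (fun k => log2 (Re (\det (1%:M + (P / (K * N)%:R)%:C *: W k))))); last first.
    by move=> k _; rewrite /logdet eqG.
  have pos k : 0 < (P / (K * N)%:R) ^+ N * Re (\det (W k)) by rewrite mulr_gt0// exprn_gt0.
  rewrite -log2_prod => [|k]; last by exact: lt_le_trans (pos k) (det_scale_le Pm (pW k)).
  apply: ler_log2.
    by apply: mulr_gt0; [apply: prodr_gt0 => k _; exact: dW|exact: exprn_gt0].
  have -> : (P / (K * N)%:R) ^+ (K * N) = \prod_(k < K) (P / (K * N)%:R) ^+ N.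
    by rewrite prodr_const card_ord -exprM [(N * K)%N]mulnC.
  rewrite mulrC -big_split /=.
  by apply: ler_prod => k _; apply/andP; split; [exact/ltW/pos|exact: det_scale_le].
move=> _ [Q [pQ [tQ ->]]]; rewrite /logdet.
have pG k : 0 < Re (\det (1%:M + bd_G H k *m Q k *m conjT (bd_G H k))).
  by have [_ h] := hc k; have [p _] := h _ (pQ k); have [] := posdef_det p.
rewrite -log2_prod//; apply: ler_log2; first by apply: prodr_gt0.
apply: (@le_trans _ _ (\prod_k (Re (\det (W k)) * ((c k + rtr (Q k)) / N%:R) ^+ N))).
  by apply: ler_prod => k _; rewrite ltW//=; have [_ h] := hc k; have [_] := h _ (pQ k).
rewrite big_split /= ler_pM2l; last by apply: prodr_gt0.
have x0 k : 0 <= (c k + rtr (Q k)) / N%:R.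
  by rewrite divr_ge0 ?ler0n// addr_ge0 ?rtr_ge0//; have [] := hc k.
(* AM-GM once more, now over the [K] users: each factor is already the [N]-th power of a mean. *)
rewrite prodrXl exprM; apply: lerXn2r; rewrite ?nnegrE ?prodr_ge0//.
  have c0 : 0 <= \sum_k c k by apply: sumr_ge0 => k _; have [] := hc k.
  by rewrite exprn_ge0// divr_ge0 ?ler0n// addr_ge0// ltW.
have -> : (\sum_k c k + P) / (K * N)%:R = (\sum_k c k + P) / N%:R / K%:R.
  by rewrite natrM; field; rewrite !gt_eqF.
apply: prod_add_le_mean => //.
by rewrite -mulr_suml ler_pM2r ?invr_gt0// big_split lerD2l.
Qed.

(** The covariances assemble into one block-diagonal matrix [Qb] of the same trace, and the upper
    bound forgets the block structure. By Sylvester's identity only [H *m conjT H] matters, so [H]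
    may be traded for the square Cholesky factor, to which [det_le_water] applies. *)
Lemma C_DPC_growth K N M (H : 'M[C]_(K * N, M)) : (0 < K * N)%N ->
  posdef (H *m conjT H) ->
  capacity_growth (C_DPC H) (K * N) (Re (\det (H *m conjT H))).
Proof.
move=> m0 pW; set W := H *m conjT H; have [_ dW] := posdef_det pW; split=> //.
have [L uL eW] := posdef_cholesky pW.
have pL : posdef (conjT L *m conjT (conjT L)).
  rewrite conjTK -[conjT L]mulmx1; apply: posdef_congr; first exact: posdef1.
  by move=> y; exact: unitmx_cinj.
have dL : \det (conjT L *m conjT (conjT L)) = \det W.
  by rewrite conjTK /W eW !det_mulmx mulrC.
have mR : 0 < (K * N)%:R :> R by rewrite ltr0n.
have sumQ (Q : 'I_K -> 'M[C]_N) :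
    \sum_k conjT (user_ch H k) *m Q k *m user_ch H k =
    conjT H *m (\sum_k conjT (usel N k) *m Q k *m usel N k) *m H.
  rewrite mulmx_sumr mulmx_suml; apply: eq_bigr => k _.
  by rewrite -mul_usel conjTM !mulmxA.
have [c c0 hc] := det_le_water pL; exists c => // P P0.
have Pm : 0 < P / (K * N)%:R by rewrite divr_gt0.
apply: sup_between.
  eexists; first exists (fun=> (P / (K * N)%:R)%:C *: 1%:M); [split; last split; last reflexivity|].
  - by move=> k; apply: psdZ; [exact: ltW|exact: psd1].
  - rewrite (eq_bigr (fun=> P / (K * N)%:R * N%:R)) => [|k _].
      by rewrite sumr_const card_ord -[_ *+ K]mulr_natr -mulrA -natrM [(N * K)%N]mulnC divfK// gt_eqF.
    rewrite /rtr mxtraceZ ReRM mxtrace1; congr (_ * _).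
    by rewrite -(rmorph_nat (real_complex R)).
  rewrite sumQ /logdet (eq_bigr (fun k => (P / (K * N)%:R)%:C *: (conjT (usel N k) *m usel N k))); last first.
    by move=> k _; rewrite -scalemxAr mulmx1 -scalemxAl.
  rewrite -scaler_sumr sum_usel -scalemxAr mulmx1 -scalemxAl scalemxAr det_mulmx_one_addC -scalemxAl.
  apply: ler_log2; first by rewrite mulr_gt0 ?exprn_gt0.
  by rewrite mulrC det_scale_le.
move=> _ [Q [pQ [tQ ->]]]; rewrite sumQ /logdet.
set Qb := \sum_k _.
have pQb : psd Qb by apply: psd_sum => k _; exact: psd_congr.
have tQb : rtr Qb <= P.
  apply: le_trans tQ; rewrite /rtr /Qb.
  have -> : \tr (\sum_k conjT (usel N k) *m Q k *m usel N k) =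
      \sum_k \tr (conjT (usel N k) *m Q k *m usel N k) by exact: raddf_sum.
  rewrite Re_sum; apply: ler_sum => k _.
  by rewrite mxtrace_mulC mulmxA usel_ortho mul1mx.
have -> : \det (1%:M + conjT H *m Qb *m H) = \det (1%:M + conjT L *m Qb *m conjT (conjT L)).
  rewrite conjTK -!mulmxA det_mulmx_one_addC [RHS]det_mulmx_one_addC.
  by rewrite -!mulmxA eW.
have [p h] := hc Qb pQb; have [_ p0] := posdef_det p.
apply: ler_log2 => //; apply: (le_trans h); rewrite dL ler_pM2l//.
apply: lerXn2r; rewrite ?nnegrE ?divr_ge0 ?ler0n ?addr_ge0 ?rtr_ge0 ?(ltW P0)//.
by rewrite ler_pM2r ?invr_gt0// lerD2l.
Qed.

End Capacity.

(** * Conditioning on a subfamily of independent variables *)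

Section SplitIntegrals.
Local Open Scope ereal_scope.

(** The Radon-Nikodym derivative agrees almost everywhere with the density, since both integrate to
    [normal_prob] on every measurable set. *)
Lemma integral_normal_prob (R : realType) (m s : R) (f : R -> \bar R) :
  (forall x, 0 <= f x) -> measurable_fun setT f ->
  \int[normal_prob m s]_x f x =
  \int[lebesgue_measure]_x (f x * (normal_pdf m s x)%:E).
Proof.
move=> f0 mf.
rewrite -(@Radon_Nikodym_SigmaFinite.change_of_variables _ _ _ _ _ (normal_prob_dominates m s))//.
have mpdf : measurable_fun [set: R] (fun x => (normal_pdf m s x)%:E).
  by apply/measurable_EFinP; exact: measurable_normal_pdf.
have iRN := Radon_Nikodym_SigmaFinite.f_integrable (normal_prob_dominates m s).
apply: ae_eq_integral => //.
- by apply: emeasurable_funM => //; exact: (measurable_int _ iRN).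
- exact: emeasurable_funM.
- apply: ae_eqe_mul2l => /=; apply: integral_ae_eq => //=.
  by move=> E _ mE; rewrite -Radon_Nikodym_SigmaFinite.f_integral//; exact: normal_prob_dominates.
Qed.

(** At variance [1/2] the density is proportional to [expR (- x ^+ 2)], which the factor
    [expR (x ^+ 2)] cancels. What remains is [r^-1] times the normal density of mean [- c / r] and
    variance [1 / (2 r ^+ 2)]. *)
Lemma gaussian_square_integral (R : realType) (r c : R) : (0 < r)%R ->
  \int[normal_prob 0 (Num.sqrt (2^-1))]_x (expR (x ^+ 2 - (r * x + c) ^+ 2))%:E
  = (r^-1)%:E.
Proof.
move=> r0; rewrite integral_normal_prob; last 2 first.
- by move=> x; rewrite lee_fin expR_ge0.
- apply/measurable_EFinP; apply: measurableT_comp => //.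
  apply: measurable_funB; first exact: measurable_funX.
  by apply: measurable_funX; apply: measurable_funD => //; exact: measurable_funM.
have s20 : (0 < Num.sqrt 2^-1 :> R)%R by rewrite sqrtr_gt0 invr_gt0.
have sr0 : (0 < Num.sqrt 2^-1 / r :> R)%R by rewrite divr_gt0.
have s2 : (Num.sqrt 2^-1 ^+ 2 = 2^-1 :> R)%R by rewrite sqr_sqrtr// invr_ge0.
transitivity (\int[lebesgue_measure]_x
    ((r^-1)%:E * (normal_pdf (- c / r) (Num.sqrt 2^-1 / r) x)%:E)); last first.
  rewrite ge0_integralZl//.
  - by rewrite integral_normal_pdf mule1.
  - by apply/measurable_EFinP; exact: measurable_normal_pdf.
  - by move=> x _; rewrite lee_fin normal_pdf_ge0.
  - by rewrite lee_fin invr_ge0 ltW.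
apply: eq_integral => x _; rewrite -!EFinM; congr EFin; rewrite !normal_pdfE ?gt_eqF//=.
have -> : normal_peak (Num.sqrt 2^-1 / r) = (r * normal_peak (Num.sqrt 2^-1))%R :> R.
  rewrite /normal_peak expr_div_n s2.
  have -> : (2^-1 / r ^+ 2 * pi *+ 2 = (2^-1 * pi *+ 2) / r ^+ 2 :> R)%R.
    by field; rewrite gt_eqF.
  rewrite sqrtrM; last by rewrite mulrn_wge0// mulr_ge0 ?invr_ge0// pi_ge0.
  by rewrite sqrtrV ?sqr_ge0// sqrtr_sqr gtr0_norm// invfM invrK mulrC.
rewrite (mulrA r^-1%R) (mulrA r^-1%R) mulVf ?gt_eqF// mul1r mulrCA; congr (_ * _)%R.
rewrite /normal_fun expr_div_n s2 -expRD; congr expR.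
by field; rewrite gt_eqF.
Qed.

Section FamilyOfVariables.
Context d (T : measurableType d) (R : realType) (Pr : probability T R).
Variables (I : finType) (X : I -> T -> R).
Hypothesis mX : forall t, measurable_fun setT (X t).
Hypothesis iX : forall (J : {set I}) (A : I -> set R), (forall t, measurable (A t)) ->
  Pr [set w | forall t, t \in J -> A t (X t w)] = \prod_(t in J) Pr (X t @^-1` A t).

Definition cylinders (J : {set I}) : set (set T) :=
  [set B | exists2 A : I -> set R, (forall t, measurable (A t)) &
    B = [set w | forall t, t \in J -> A t (X t w)]].

Lemma cylinders_setI J : setI_closed (cylinders J).
Proof.
move=> _ _ [A mA ->] [A' mA' ->]; exists (fun t => A t `&` A' t).
  by move=> t; exact: measurableI.
apply/seteqP; split=> w /=; first by move=> [h h'] t tJ; split; [exact: h|exact: h'].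
by move=> h; split=> t tJ; have [] := h t tJ.
Qed.

Lemma cylinders_setT J : cylinders J setT.
Proof. by exists (fun=> setT) => //; apply/seteqP; split. Qed.

Lemma cylinders_measurable J : cylinders J `<=` measurable.
Proof.
move=> _ [A mA ->].
have -> : [set w | forall t, t \in J -> A t (X t w)] =
    \bigcap_(t in [set` J]) (X t @^-1` A t) by [].
apply: fin_bigcap_measurable => [|t _]; first exact: finite_finset.
by rewrite -[X in measurable X]setTI; exact: mX.
Qed.

Lemma cylinders_indep (J J' : {set I}) B B' : disjoint (mem J) (mem J') ->
  cylinders J B -> cylinders J' B' -> Pr (B `&` B') = Pr B * Pr B'.
Proof.
move=> JJ' [A mA ->] [A' mA' ->].
have -> : [set w | forall t, t \in J -> A t (X t w)] `&`
    [set w | forall t, t \in J' -> A' t (X t w)] =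
    [set w | forall t, t \in J :|: J' -> (if t \in J then A t else A' t) (X t w)].
  apply/seteqP; split=> w /=.
    by move=> [h h'] t; rewrite inE; case: ifP => [tJ _|_ /= tJ']; [exact: h|exact: h'].
  move=> h; split=> t tJ; have := h t; rewrite inE tJ ?orbT => /(_ isT) //.
  by case: ifP => // tJ2; have := disjointFr JJ' tJ2; rewrite tJ.
rewrite (iX J mA) (iX J' mA') (iX _ (A := fun t => if t \in J then A t else A' t)); last first.
  by move=> t; case: (t \in J).
rewrite (big_setID J) /= finset.setUK; congr (_ * _).
  by apply: eq_bigr => t tJ; rewrite tJ.
apply: eq_big => t; last by rewrite inE => /andP[/negbTE ->].
rewrite !inE; case: (boolP (t \in J)) => //= tJ.
by rewrite (disjointFr JJ' tJ).
Qed.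

(** For fixed [B'] both sides are finite measures in [B] that agree on the cylinders, a generating
    family closed under intersection. [sigma_cylinders_indep] repeats the argument in [B']. *)
Lemma cylinders_indepL (J J' : {set I}) B B' : disjoint (mem J) (mem J') ->
  <<s cylinders J >> B -> cylinders J' B' -> Pr (B `&` B') = Pr B * Pr B'.
Proof.
move=> JJ' sB cB'; have mB' := cylinders_measurable cB'.
have pf : (0 <= fine (Pr B'))%R by exact: fine_ge0.
pose m1 := mrestr Pr mB'; pose m2 := mscale (NngNum pf) Pr.
have := @g_sigma_algebra_measure_unique _ _ _ (cylinders J) (@cylinders_measurable J)
   (fun=> setT) (fun=> cylinders_setT J) _ m1 m2 (@cylinders_setI J) _ _ B sB.
rewrite /m1 /m2 /= /mrestr /mscale /= => ->.
- by rewrite fineK ?fin_num_measure// muleC.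
- by rewrite bigcup_const.
- by move=> A cA; rewrite (cylinders_indep JJ')// fineK ?fin_num_measure// muleC.
- by move=> _; rewrite setTI (le_lt_trans (probability_le1 _ _))// ltry.
Qed.

Lemma sigma_cylinders_indep (J J' : {set I}) B B' : disjoint (mem J) (mem J') ->
  <<s cylinders J >> B -> <<s cylinders J' >> B' -> Pr (B `&` B') = Pr B * Pr B'.
Proof.
move=> JJ' sB sB'.
have mB : measurable B.
  exact: (smallest_sub (@sigma_algebra_measurable _ T) (@cylinders_measurable J)) sB.
have pf : (0 <= fine (Pr B))%R by exact: fine_ge0.
pose m1 := mrestr Pr mB; pose m2 := mscale (NngNum pf) Pr.
have := @g_sigma_algebra_measure_unique _ _ _ (cylinders J') (@cylinders_measurable J')
   (fun=> setT) (fun=> cylinders_setT J') _ m1 m2 (@cylinders_setI J') _ _ B' sB'.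
rewrite setIC => h; rewrite /m1 /m2 /= /mrestr /mscale /= in h; rewrite h.
- by rewrite fineK ?fin_num_measure.
- by rewrite bigcup_const.
- by move=> A cA; rewrite setIC (cylinders_indepL JJ')// fineK ?fin_num_measure.
- by move=> _; rewrite setTI (le_lt_trans (probability_le1 _ _))// ltry.
Qed.

(* The sample space with only the events generated by the [X t], [t \in J]:
   measurability over it encodes dependence on these variables alone. *)
Definition sub_space (J : {set I}) := g_sigma_algebraType (cylinders J).

Lemma measurable_coord (J : {set I}) t : t \in J -> measurable_fun [set: sub_space J] (X t).
Proof.
move=> tJ _ A mA; rewrite setTI; apply: sub_sigma_algebra.
exists (fun s => if s == t then A else setT); first by move=> s; case: ifP.
apply/seteqP; split=> w /=; first by move=> h s sJ; case: eqP => // ->.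
by move=> /(_ t tJ); rewrite eqxx.
Qed.

Lemma measurable_id_sub J : measurable_fun [set: T] (fun w => w : sub_space J).
Proof.
move=> _ A mA; rewrite setTI.
exact: (smallest_sub (@sigma_algebra_measurable _ T) (@cylinders_measurable J)) mA.
Qed.

(** By independence, [w |-> (w, w)] pushes [Pr] to the product of the two marginal laws, and Tonelli
    integrates one group of variables with the other frozen. Measurability of [phi] on this product
    records which group enters through which argument. *)
Lemma integral_split (J J' : {set I}) (phi : sub_space J * sub_space J' -> \bar R) :
  disjoint (mem J) (mem J') -> measurable_fun setT phi -> (forall z, 0 <= phi z) ->
  \int[Pr]_w phi (w, w) = \int[Pr]_w \int[Pr]_v phi (v, w).
Proof.
move=> JJ' mphi phi0.
pose i1 : T -> sub_space J := fun w => w; pose i2 : T -> sub_space J' := fun w => w.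
pose dg : T -> (sub_space J * sub_space J')%type := fun w => (w, w).
have mi1 : measurable_fun setT i1 := @measurable_id_sub J.
have mi2 : measurable_fun setT i2 := @measurable_id_sub J'.
have mdg : measurable_fun setT dg by apply/measurable_fun_pairP; split.
pose Mi1 := isMeasurableFun.Build _ _ _ _ _ mi1; pose Fi1 : {mfun T >-> _} := HB.pack i1 Mi1.
pose Mi2 := isMeasurableFun.Build _ _ _ _ _ mi2; pose Fi2 : {mfun T >-> _} := HB.pack i2 Mi2.
pose Mdg := isMeasurableFun.Build _ _ _ _ _ mdg; pose Fdg : {mfun T >-> _} := HB.pack dg Mdg.
pose m1 : probability _ R := distribution Pr Fi1.
pose m2 : probability _ R := distribution Pr Fi2.
pose m' : probability _ R := distribution Pr Fdg.
have mE : forall B, measurable B -> (m1 \x m2) B = m' B.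
  apply: product_measure_unique => A B mA mB.
  rewrite /m' /m1 /m2 /distribution /= /pushforward /=.
  exact: (sigma_cylinders_indep JJ' mA mB).
transitivity (\int[m']_z phi z).
  by rewrite /m' /distribution /= ge0_integral_pushforward.
transitivity (\int[m1 \x m2]_z phi z).
  by apply: eq_measure_integral => B mB _; exact/esym/mE.
rewrite fubini_tonelli2// /fubini_G.
rewrite /m2 /distribution /= ge0_integral_pushforward//=.
- apply: eq_integral => w _ /=; rewrite /m1 /distribution /= ge0_integral_pushforward//.
  exact: measurableT_comp.
- exact: measurable_fun_fubini_tonelli_G.
- by move=> y _; apply: integral_ge0.
Qed.

End FamilyOfVariables.
End SplitIntegrals.

(** * Gains of Gaussian rows *)

Section ComplexMeasurable.
Context d (S : measurableType d) (R : realType).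
Local Notation C := (R[i]).
Local Notation Re := (@complex.Re R).
Local Notation Im := (@complex.Im R).
Local Notation "x %:C" := (real_complex R x).

Lemma measurable_inv : measurable_fun [set: R] (fun x : R => x^-1).
Proof.
have -> : [set: R] = [set 0] `|` ~` [set 0] by rewrite setUv.
apply/measurable_funU => //; first exact: measurableC.
split; first exact: measurable_fun_set1.
apply: open_continuous_measurable_fun.
  by apply: closed_openC; exact: closed_eq.
by move=> x /set_mem /= /eqP x0; exact: inv_continuous.
Qed.

Definition cmeas (f : S -> C) : Prop :=
  measurable_fun setT (fun w => Re (f w)) /\ measurable_fun setT (fun w => Im (f w)).

Lemma cmeas_cst (z : C) : cmeas (fun=> z). Proof. by split. Qed.
Lemma cmeasD f g : cmeas f -> cmeas g -> cmeas (fun w => f w + g w).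
Proof.
move=> [f1 f2] [g1 g2]; split.
  by under eq_fun do rewrite ReD; exact: measurable_funD.
by under eq_fun do rewrite ImD; exact: measurable_funD.
Qed.
Lemma cmeasN f : cmeas f -> cmeas (fun w => - f w).
Proof.
move=> [f1 f2]; split.
  by under eq_fun do rewrite ReN; exact: measurableT_comp.
by under eq_fun do rewrite ImN; exact: measurableT_comp.
Qed.
Lemma cmeasM f g : cmeas f -> cmeas g -> cmeas (fun w => f w * g w).
Proof.
move=> [f1 f2] [g1 g2]; split.
  by under eq_fun do rewrite ReM; apply: measurable_funB; exact: measurable_funM.
by under eq_fun do rewrite ImM; apply: measurable_funD; exact: measurable_funM.
Qed.
Lemma cmeasJ f : cmeas f -> cmeas (fun w => conjc (f w)).
Proof.
move=> [f1 f2]; split.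
  by rewrite (_ : (fun w => _) = (fun w => Re (f w)))//; apply/funext => w; case: (f w).
rewrite (_ : (fun w => _) = (fun w => - Im (f w))); last by apply/funext => w; case: (f w).
exact: measurableT_comp.
Qed.
Lemma cmeas_real (g : S -> R) : measurable_fun setT g -> cmeas (fun w => (g w)%:C).
Proof. by move=> mg; split. Qed.
Lemma cmeas_sum (I : Type) (r : seq I) (P : pred I) (F : I -> S -> C) :
  (forall i, P i -> cmeas (F i)) -> cmeas (fun w => \sum_(i <- r | P i) F i w).
Proof.
move=> h; elim: r => [|a r IH]; first by under eq_fun do rewrite big_nil; exact: cmeas_cst.
under eq_fun do rewrite big_cons.
by case: (boolP (P a)) => // Pa; apply: cmeasD => //; exact: h.
Qed.
Lemma cmeas_prod (I : Type) (r : seq I) (P : pred I) (F : I -> S -> C) :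
  (forall i, P i -> cmeas (F i)) -> cmeas (fun w => \prod_(i <- r | P i) F i w).
Proof.
move=> h; elim: r => [|a r IH]; first by under eq_fun do rewrite big_nil; exact: cmeas_cst.
under eq_fun do rewrite big_cons.
by case: (boolP (P a)) => // Pa; apply: cmeasM => //; exact: h.
Qed.

Definition mxmeas p q (F : S -> 'M[C]_(p, q)) : Prop := forall i j, cmeas (fun w => F w i j).

Lemma mxmeas_cst p q (A : 'M[C]_(p, q)) : mxmeas (fun=> A).
Proof. by move=> i j; exact: cmeas_cst. Qed.
Lemma mxmeasD p q (F G : S -> 'M[C]_(p, q)) : mxmeas F -> mxmeas G -> mxmeas (fun w => F w + G w).
Proof. by move=> mF mG i j; under eq_fun do rewrite mxE; exact: cmeasD. Qed.
Lemma mxmeasN p q (F : S -> 'M[C]_(p, q)) : mxmeas F -> mxmeas (fun w => - F w).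
Proof. by move=> mF i j; under eq_fun do rewrite mxE; exact: cmeasN. Qed.
Lemma mxmeasZ p q (a : S -> C) (F : S -> 'M[C]_(p, q)) : cmeas a -> mxmeas F ->
  mxmeas (fun w => a w *: F w).
Proof. by move=> ma mF i j; under eq_fun do rewrite mxE; exact: cmeasM. Qed.
Lemma mxmeasM p q r (F : S -> 'M[C]_(p, q)) (G : S -> 'M[C]_(q, r)) :
  mxmeas F -> mxmeas G -> mxmeas (fun w => F w *m G w).
Proof.
by move=> mF mG i j; under eq_fun do rewrite mxE; apply: cmeas_sum => k _; exact: cmeasM.
Qed.
Lemma mxmeasJ p q (F : S -> 'M[C]_(p, q)) : mxmeas F -> mxmeas (fun w => conjT (F w)).
Proof. by move=> mF i j; under eq_fun do rewrite conjTE; exact: cmeasJ. Qed.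
Lemma cmeas_det n (F : S -> 'M[C]_n) : mxmeas F -> cmeas (fun w => \det (F w)).
Proof.
move=> mF; apply: cmeas_sum => s _; apply: cmeasM; first exact: cmeas_cst.
by apply: cmeas_prod => i _; exact: mF.
Qed.

Lemma mxmeas_cproj m n (H : S -> 'M[C]_(m, n)) (s : seq 'I_m) :
  (forall i, i \in s -> mxmeas (fun w => row i (H w))) ->
  mxmeas (fun w => cproj [seq row i (H w) | i <- s]).
Proof.
elim: s => [_|a s IH h]; first exact: mxmeas_cst.
have mQ : mxmeas (fun w => cproj [seq row i (H w) | i <- s]).
  by apply: IH => i si; apply: h; rewrite inE si orbT.
have ma : mxmeas (fun w => row a (H w)) by apply: h; rewrite mem_head.
rewrite /=; apply: mxmeasD => //; apply: mxmeasN; apply: mxmeasZ.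
  apply: cmeas_real; apply: (measurableT_comp measurable_inv).
  by have [] := mxmeasM (mxmeasM ma mQ) (mxmeasJ ma) 0 0.
apply: mxmeasM; last exact: mxmeasM.
by apply: mxmeasM => //; exact: mxmeasJ.
Qed.

Lemma measurable_gain m n (F : S -> 'rV[C]_n) (H : S -> 'M[C]_(m, n)) (s : seq 'I_m) :
  mxmeas F -> (forall i, i \in s -> mxmeas (fun w => row i (H w))) ->
  measurable_fun setT (fun w => gain [seq row i (H w) | i <- s] (F w)).
Proof.
move=> mF mH; have mQ := mxmeas_cproj mH.
by have [] := mxmeasM (mxmeasM mF mQ) (mxmeasJ mF) 0 0.
Qed.

End ComplexMeasurable.

Section GaussianRows.
Context d (T : measurableType d) (R : realType) (Pr : probability T R).
Variables (m n : nat) (H : T -> 'M[R[i]]_(m, n)).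
Hypothesis iidH : iid_CN01 Pr H.
Local Notation C := (R[i]).
Local Notation Re := (@complex.Re R).
Local Notation Im := (@complex.Im R).
Local Notation "x %:C" := (real_complex R x).
Local Notation X := (entry_rv H).
Local Notation subs J := (sub_space X J).

Let mX t : measurable_fun setT (X t). Proof. by have [h _] := iidH. Qed.
Let iX (J : {set 'I_m * 'I_n * bool}) (A : 'I_m * 'I_n * bool -> set R) :
  (forall t, measurable (A t)) ->
  Pr [set w | forall t, t \in J -> A t (X t w)] = (\prod_(t in J) Pr (X t @^-1` A t))%E.
Proof. by have [_ [_ h]] := iidH; exact: h. Qed.

Lemma integral_entry t (f : R -> \bar R) : (forall x, (0 <= f x)%E) -> measurable_fun setT f ->
  (\int[Pr]_w f (X t w) = \int[normal_prob 0 (Num.sqrt (2^-1))]_x f x)%E.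
Proof.
move=> f0 mf.
have mXt : @measurable_fun _ _ T (measurableTypeR R) setT (X t) := mX t.
pose MX := isMeasurableFun.Build _ _ _ _ _ mXt.
pose FX : {mfun T >-> measurableTypeR R} := HB.pack (X t) MX.
transitivity (\int[distribution Pr FX]_x f x)%E.
  by rewrite /distribution /= ge0_integral_pushforward.
apply: eq_measure_integral => A mA _; rewrite /distribution /= /pushforward.
by have [_ [h _]] := iidH; exact: h.
Qed.

Definition nsq (z : C) : R := Re z ^+ 2 + Im z ^+ 2.

Lemma measurable_nsq d' (S : measurableType d') (f : S -> C) : cmeas f ->
  measurable_fun setT (fun w => nsq (f w)).
Proof. by move=> [f1 f2]; apply: measurable_funD; exact: measurable_funX. Qed.

Lemma cmeas_entry_sub (J : {set 'I_m * 'I_n * bool}) i j : (forall b, (i, j, b) \in J) ->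
  @cmeas _ (subs J) R (fun w => H w i j).
Proof.
move=> h; split.
  exact: (@measurable_coord _ _ _ _ X J (i, j, true) (h true)).
exact: (@measurable_coord _ _ _ _ X J (i, j, false) (h false)).
Qed.

Lemma cmeas_comp d1 d2 (S1 : measurableType d1) (S2 : measurableType d2)
  (f : S2 -> C) (g : S1 -> S2) : measurable_fun setT g -> cmeas f -> cmeas (fun w => f (g w)).
Proof.
by move=> mg [f1 f2]; split; [exact: (measurableT_comp f1)|exact: (measurableT_comp f2)].
Qed.

(** As [r] is real, the exponent separates into a function of the real part and one of the imaginary
    part, which are independent; each contributes [r^-1]. *)
Lemma entry_gauss i j (r : R) (c : C) : 0 < r ->
  (\int[Pr]_w (expR (nsq (H w i j) - nsq (H w i j * r%:C + c)))%:E = ((r ^+ 2)^-1)%:E)%E.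
Proof.
move=> r0.
pose g (a x : R) := expR (x ^+ 2 - (r * x + a) ^+ 2).
have mg a : measurable_fun setT (g a).
  apply: measurableT_comp => //; apply: measurable_funB; first exact: measurable_funX.
  by apply: measurable_funX; apply: measurable_funD => //; exact: measurable_funM.
have eg w : expR (nsq (H w i j) - nsq (H w i j * r%:C + c)) =
    g (Re c) (X (i, j, true) w) * g (Im c) (X (i, j, false) w).
  rewrite /g -expRD /nsq /entry_rv /= ReD ImD ReM ImM /=; congr expR; ring.
pose J := [set (i, j, true)]%SET; pose J' := [set (i, j, false)]%SET.
have dJ : disjoint (mem J) (mem J').
  by rewrite disjoints1 inE; apply/eqP.
pose phi (z : subs J * subs J') : \bar R :=
  (g (Re c) (X (i, j, true) z.1) * g (Im c) (X (i, j, false) z.2))%:E.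
have mphi : measurable_fun setT phi.
  apply/measurable_EFinP/measurable_funM; apply: (measurableT_comp (mg _)).
    apply: (measurableT_comp (measurable_coord _)) => //; first by rewrite inE.
  by apply: (measurableT_comp (measurable_coord _)) => //; rewrite inE.
have phi0 z : (0 <= phi z)%E by rewrite lee_fin mulr_ge0// expR_ge0.
under eq_integral do rewrite eg.
have := integral_split mX iX dJ mphi phi0; rewrite /phi /= => ->.
have gi a t : (\int[Pr]_w (g a (X t w))%:E = (r^-1)%:E)%E.
  rewrite (@integral_entry t (fun x => (g a x)%:E)).
  - exact: gaussian_square_integral.
  - by move=> x; rewrite lee_fin expR_ge0.
  - exact/measurable_EFinP.
under eq_integral => w _.
  under eq_integral do rewrite mulrC EFinM.
  rewrite ge0_integralZl//; last 3 first.
  - by apply/measurable_EFinP; apply: (measurableT_comp (mg _)).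
  - by move=> x _; rewrite lee_fin expR_ge0.
  - by rewrite lee_fin expR_ge0.
  rewrite gi; over.
rewrite ge0_integralZr//; last 3 first.
- by apply/measurable_EFinP; apply: (measurableT_comp (mg _)).
- by move=> x _; rewrite lee_fin expR_ge0.
- by rewrite lee_fin invr_ge0 ltW.
by rewrite gi -EFinM -invfM expr2.
Qed.

(* The coordinates of [h *m L] involve [h 0 k] for [k >= j] only, so the entries
   can be integrated out one at a time. *)
Lemma row_gauss_trig i (L : 'M[C]_n) (r : 'I_n -> R) :
  is_trig_mx L -> (forall j, L j j = (r j)%:C) -> (forall j, 0 < r j) ->
  (\int[Pr]_w (expR (\sum_j (nsq (H w i j) - nsq ((row i (H w) *m L) 0%R j))))%:E
   = (\prod_j (r j ^+ 2)^-1)%:E)%E.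
Proof.
move=> tL dL r0.
pose c (j : 'I_n) w : C := \sum_(k < n | (j < k)%N) H w i k * L k j.
have hL w j : (row i (H w) *m L) 0 j = H w i j * (r j)%:C + c j w.
  rewrite mxE (bigID (fun k : 'I_n => (k <= j)%N)) /= (bigD1 j)//= !mxE dL.
  rewrite [X in _ + X + _]big1 ?addr0 => [|k /andP[kj nkj]]; last first.
    by have /is_trig_mxP -> := tL; rewrite ?mulr0// ltn_neqAle kj andbT.
  by congr (_ + _); apply: eq_big => k; rewrite ?ltnNge// mxE.
(* [e l] keeps the coordinates from [l] on. Among these, entry [l] of the row enters only coordinate
   [l], where the later entries act as the shift [c]; it is integrated first, and [k] counts the
   coordinates kept. *)
pose e l w := \sum_(j < n | (l <= j)%N) (nsq (H w i j) - nsq ((row i (H w) *m L) 0 j)).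
suff main : forall k l, (l + k = n)%N ->
    (\int[Pr]_w (expR (e l w))%:E = (\prod_(j < n | (l <= j)%N) (r j ^+ 2)^-1)%:E)%E.
  by have := main n 0%N (add0n n).
elim=> [|k IH] l lk.
  have e0 (V : zmodType) (F : 'I_n -> V) : \sum_(j < n | (l <= j)%N) F j = 0.
    by apply: big_pred0 => j; rewrite leqNgt -(addn0 l) lk ltn_ord.
  rewrite (_ : \prod_(j < n | _) _ = 1); last first.
    by apply: big_pred0 => j; rewrite leqNgt -(addn0 l) lk ltn_ord.
  under eq_integral do rewrite /e e0 expR0.
  by rewrite integral_cst//= mul1e probability_setT.
have ln : (l < n)%N by lia.
pose jl := Ordinal ln.
have pred_split (j : 'I_n) : (l <= j)%N && (j != jl) = (l.+1 <= j)%N.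
  by rewrite ltn_neqAle andbC eq_sym.
pose J := [set t : 'I_m * 'I_n * bool | t.1 == (i, jl)]%SET.
pose J' := [set t : 'I_m * 'I_n * bool | (t.1.1 == i) && (l < t.1.2)%N]%SET.
have dJ : disjoint (mem J) (mem J').
  rewrite disjoint_subset; apply/fintype.subsetP => -[[a b] x]; rewrite !inE /= => /eqP[-> ->].
  by rewrite ltnn andbF.
have mJ : @cmeas _ (subs J) R (fun w => H w i jl).
  by apply: cmeas_entry_sub => b; rewrite inE.
have mJ' (j : 'I_n) : (l < j)%N -> @cmeas _ (subs J') R (fun w => H w i j).
  by move=> lj; apply: cmeas_entry_sub => b; rewrite inE /= eqxx.
have mc (j : 'I_n) : (l <= j)%N -> @cmeas _ (subs J') R (c j).
  move=> lj; apply: cmeas_sum => q jq; apply: cmeasM; last exact: cmeas_cst.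
  by apply: mJ'; exact: leq_ltn_trans jq.
have me : measurable_fun [set: subs J'] (e l.+1).
  have -> : e l.+1 = fun w => \sum_(j < n) (if (l.+1 <= j)%N then
      nsq (H w i j) - nsq ((row i (H w) *m L) 0 j) else 0).
    by apply/funext => w; rewrite /e big_mkcond.
  apply: measurable_sum => j; case: (boolP (l.+1 <= j)%N) => lj; last exact: measurable_cst.
  under eq_fun do rewrite hL.
  apply: measurable_funB; apply: measurable_nsq; first exact: mJ'.
  apply: cmeasD; last by apply: mc; exact: ltnW.
  by apply: cmeasM; [exact: mJ'|exact: cmeas_cst].
pose phi (z : subs J * subs J') : \bar R :=
  (expR (nsq (H z.1 i jl) - nsq (H z.1 i jl * (r jl)%:C + c jl z.2)) * expR (e l.+1 z.2))%:E.
have mphi : measurable_fun setT phi.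
  apply/measurable_EFinP/measurable_funM; apply: measurableT_comp => //.
    apply: measurable_funB; apply: measurable_nsq.
      exact: (cmeas_comp measurable_fst mJ).
    apply: cmeasD; last exact: (cmeas_comp measurable_snd (mc jl (leqnn l))).
    by apply: cmeasM; [exact: (cmeas_comp measurable_fst mJ)|exact: cmeas_cst].
  exact: (measurableT_comp me).
have phi0 z : (0 <= phi z)%E by rewrite lee_fin mulr_ge0// expR_ge0.
transitivity (\int[Pr]_w phi (w, w))%E.
  apply: eq_integral => w _; rewrite /phi /= -expRD /e (bigD1 jl)//= hL; congr (expR (_ + _))%:E.
  by apply: eq_bigl => j; rewrite pred_split.
have := integral_split mX iX dJ mphi phi0 => ->; rewrite /phi /=.
under eq_integral => w _.
  under eq_integral do rewrite mulrC EFinM.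
  rewrite ge0_integralZl//; last first.
  - apply/measurable_EFinP; apply: measurableT_comp => //.
    have mE : @cmeas _ T R (fun v => H v i jl).
      by split; [exact: (mX (i, jl, true))|exact: (mX (i, jl, false))].
    apply: measurable_funB; apply: measurable_nsq => //.
    by apply: cmeasD; [apply: cmeasM => //; exact: cmeas_cst|exact: cmeas_cst].
  rewrite entry_gauss//; over.
rewrite ge0_integralZr//; last 2 first.
- apply/measurable_EFinP; apply: measurableT_comp => //.
  exact: (measurableT_comp me (@measurable_id_sub _ _ _ _ X mX J')).
- by rewrite lee_fin invr_ge0 sqr_ge0.
rewrite IH; last by rewrite addSnnS.
rewrite -EFinM mulrC (bigD1 jl (P := fun j => (l <= j)%N))//=; congr (_ * _)%:E.
by apply: eq_bigl => j; rewrite pred_split.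
Qed.

(* With [1 + t P = L L^*] for the projector [P], [- t * gain s h] is
   [|h|^2 - |h L|^2]. *)
Lemma row_laplace i (s : seq 'rV[C]_n) (t : R) : -1 < t ->
  (\int[Pr]_w (expR (- t * gain s (row i (H w))))%:E =
   ((Re (\det (1%:M + t%:C *: cproj s)))^-1)%:E)%E.
Proof.
move=> t1; have [L [r [tL dL r0 eL]]] := cholesky (posdef_one_cproj s t1).
rewrite eL (trig_gram_det tL dL) /= -prodfV -(row_gauss_trig i tL dL r0).
apply: eq_integral => w _; congr (expR _)%:E.
have nE (u : 'rV[C]_n) : Re ((u *m conjT u) 0 0) = \sum_j nsq (u 0 j).
  by rewrite mxE Re_sum; apply: eq_bigr => j _; rewrite conjTE mulcJ_real.
set h := row i (H w).
have h1 : Re ((h *m (1%:M + t%:C *: cproj s) *m conjT h) 0 0) =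
    Re ((h *m conjT h) 0 0) + t * gain s h.
  by rewrite mulmxDr mulmx1 mulmxDl mxE ReD -scalemxAr -scalemxAl [X in _ + Re X]mxE ReRM.
have h2 : Re ((h *m (1%:M + t%:C *: cproj s) *m conjT h) 0 0) =
    Re ((h *m L *m conjT (h *m L)) 0 0).
  by rewrite eL conjTM !mulmxA.
rewrite (eq_bigr (fun j => nsq (h 0 j) - nsq ((h *m L) 0 j))); last first.
  by move=> j _; rewrite [h 0 j]mxE.
by rewrite sumrB -!nE -h2 h1; ring.
Qed.

Definition rows_of (s : seq 'I_m) w : seq 'rV[C]_n := [seq row j (H w) | j <- s].

Lemma mxmeas_row (F : T -> 'M[C]_(m, n)) d' (S : measurableType d') (g : S -> T) i :
  (forall j, cmeas (fun w => F (g w) i j)) -> mxmeas (fun w => row i (F (g w))).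
Proof. by move=> h x j; under eq_fun do rewrite mxE; exact: h. Qed.

Lemma cmeas_entry i j : cmeas (fun w => H w i j).
Proof. by split; [exact: (mX (i, j, true))|exact: (mX (i, j, false))]. Qed.

Lemma measurable_gain_rows s i : measurable_fun setT (fun w => gain (rows_of s w) (row i (H w))).
Proof.
by apply: measurable_gain => [|j _]; apply: (@mxmeas_row H _ T id) => k; exact: cmeas_entry.
Qed.

(** This is the transform of a Gamma law of shape [n - size s]. With the rows of [s] frozen,
    integrating row [i] leaves a determinant that by [det_cproj] has the same value for almost all
    of them. *)
Lemma gain_laplace i s (t : R) : -1 < t -> i \notin s ->
  {ae Pr, forall w, pivots (rows_of s w)} ->
  (\int[Pr]_w (expR (- t * gain (rows_of s w) (row i (H w))))%:E =
   ((1 + t) ^+ size s / (1 + t) ^+ n)%:E)%E.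
Proof.
move=> t1 nis aes.
have t0 : 0 < 1 + t by lra.
pose J := [set t : 'I_m * 'I_n * bool | t.1.1 == i]%SET.
pose J' := [set t : 'I_m * 'I_n * bool | t.1.1 \in s]%SET.
have dJ : disjoint (mem J) (mem J').
  rewrite disjoint_subset; apply/fintype.subsetP => -[[a b] x]; rewrite !inE /= => /eqP ->.
  exact: nis.
pose phi (z : subs J * subs J') : \bar R :=
  (expR (- t * gain (rows_of s z.2) (row i (H z.1))))%:E.
have mphi : measurable_fun setT phi.
  apply/measurable_EFinP; apply: measurableT_comp => //; apply: measurable_funM => //.
  apply: (@measurable_gain _ _ _ _ _ (fun z : subs J * subs J' => row i (H z.1))
    (fun z : subs J * subs J' => H z.2)).
    apply: (@mxmeas_row H _ _ (fun z : subs J * subs J' => z.1)) => j.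
    apply: (@cmeas_comp _ _ _ _ (fun v : subs J => H v i j) _ measurable_fst).
    by apply: cmeas_entry_sub => b; rewrite inE.
  move=> k ks; apply: (@mxmeas_row H _ _ (fun z : subs J * subs J' => z.2)) => j.
  apply: (@cmeas_comp _ _ _ _ (fun v : subs J' => H v k j) _ measurable_snd).
  by apply: cmeas_entry_sub => b; rewrite inE.
have phi0 z : (0 <= phi z)%E by rewrite lee_fin expR_ge0.
have := integral_split mX iX dJ mphi phi0; rewrite /phi /= => ->.
under eq_integral do rewrite row_laplace//.
have detE w : pivots (rows_of s w) ->
    Re (\det (1%:M + t%:C *: cproj (rows_of s w))) = (1 + t) ^+ n / (1 + t) ^+ size s.
  move=> ps; have := det_cproj t1 ps; rewrite size_map.
  have /posdef_det[-> _] := posdef_one_cproj (rows_of s w) t1.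
  rewrite -!rmorphXn -rmorphM => /complexI <-.
  by rewrite mulfK// expf_neq0// gt_eqF.
transitivity (\int[Pr]_w (((1 + t) ^+ size s / (1 + t) ^+ n)%:E : \bar R))%E; last first.
  by rewrite integral_cst//= probability_setT mule1.
apply: ge0_ae_eq_integral => //.
- apply/measurable_EFinP; apply: (measurableT_comp (@measurable_inv R)).
  have mP : mxmeas (fun w => cproj (rows_of s w)).
    apply: mxmeas_cproj => j _; apply: (@mxmeas_row H _ T id) => k; exact: cmeas_entry.
  have [] // := @cmeas_det _ T R n (fun w => 1%:M + t%:C *: cproj (rows_of s w)) _.
  by apply: mxmeasD; [exact: mxmeas_cst|apply: mxmeasZ => //; exact: cmeas_cst].
- move=> w _; rewrite lee_fin invr_ge0 ltW//.
  by have [] := posdef_det (posdef_one_cproj (rows_of s w) t1).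
- by move=> w _; rewrite lee_fin divr_ge0// exprn_ge0// ltW.
- by apply: filterS aes => w ps _; rewrite detE// invf_div.
Qed.

(* The Laplace transform bounds the mass of the atom at [0] by [(1 + t)^-1]. *)
Lemma gain_gt0_ae i s : i \notin s -> (size s < n)%N ->
  {ae Pr, forall w, pivots (rows_of s w)} ->
  {ae Pr, forall w, gain (rows_of s w) (row i (H w)) != 0}.
Proof.
move=> nis sn aes; pose g w := gain (rows_of s w) (row i (H w)).
pose N := g @^-1` [set 0].
have mg : measurable_fun setT g by exact: measurable_gain_rows.
have mN : measurable N by rewrite -[N]setTI; exact: mg.
exists N; split => //; last by move=> w /= /negP/negPn/eqP.
have bound t : 0 < t -> (Pr N <= ((1 + t)^-1)%:E)%E.
  move=> t0; have t1 : -1 < t by lra.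
  have gl := gain_laplace t1 nis aes.
  apply: (@le_trans _ _ (\int[Pr]_w (expR (- t * g w))%:E)%E).
    have -> : Pr N = (\int[Pr]_w (\1_N w)%:E)%E by rewrite integral_indic// setIT.
    apply: ge0_le_integral => //.
    - by apply/measurable_EFinP; exact: measurable_indic.
    - by apply/measurable_EFinP; apply: measurableT_comp => //; exact: measurable_funM.
    - move=> w _; rewrite lee_fin indicE; case: (boolP (w \in N)) => [|_]; last exact: expR_ge0.
      by rewrite inE /N /= => ->; rewrite mulr0 expR0.
  rewrite gl lee_fin; set b := 1 + t; pose k := (n - (size s).+1)%N.
  have b0 : 0 < b by rewrite /b; lra.
  have -> : b ^+ n = b ^+ size s * (b * b ^+ k).
    by rewrite -exprS -exprD; congr (_ ^+ _); rewrite /k; lia.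
  have a0 : 0 < b ^+ size s by exact: exprn_gt0.
  have c0 : 0 < b ^+ k by exact: exprn_gt0.
  rewrite ler_pdivrMr ?mulr_gt0// (_ : b^-1 * _ = b ^+ size s * b ^+ k); last first.
    by field; rewrite gt_eqF.
  by rewrite ler_peMr// ?(ltW a0)// exprn_ege1// /b; lra.
apply/eqP; rewrite eq_le measure_ge0 andbT.
have fN : Pr N \is a fin_num by exact: fin_num_measure.
rewrite -(fineK fN) lee_fin leNgt; apply/negP => p0.
(* With [p = Pr N > 0], the choice [t = p^-1] gives [p <= p / (p + 1)], which is absurd. *)
have := bound (fine (Pr N))^-1; rewrite invr_gt0 => /(_ p0); rewrite -{1}(fineK fN) lee_fin.
set p := fine _ in p0 *.
have -> : (1 + p^-1)^-1 = p / (p + 1) by field; rewrite !gt_eqF// addr_gt0.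
rewrite ler_pdivlMr ?addr_gt0//; nra.
Qed.

Lemma pivots_ae s : uniq s -> (size s <= n)%N -> {ae Pr, forall w, pivots (rows_of s w)}.
Proof.
elim: s => [_ _|a s IH /= /andP[nas us] sn]; first exact: aeW.
have aes := IH us (ltnW sn).
by apply: filterS2 (gain_gt0_ae nas sn aes) aes => w g0 ps; split.
Qed.

End GaussianRows.

(** * Expected logarithms *)

Section RealIntegrals.
Variable R : realType.
Local Notation mu := (@lebesgue_measure R).

Lemma derivable_continuous (f : R -> R) (x : R) :
  derivable f x 1 -> {for x, continuous f}.
Proof. by move=> df1; apply: differentiable_continuous; exact/derivable1_diffP. Qed.

Lemma is_derive_derivable (f : R -> R) (x df : R) :
  is_derive x 1 f df -> derivable f x 1 /\ derive1 f x = df.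
Proof. by move=> [d1 d2]; rewrite derive1E. Qed.

Lemma FTC_segment (f F : R -> R) (a b : R) : a < b ->
  (forall x, a <= x -> x <= b -> derivable F x 1 /\ derive1 F x = f x) ->
  (forall x, a <= x -> x <= b -> {for x, continuous f}) ->
  (\int[mu]_(x in `[a, b]) (f x)%:E = (F b - F a)%:E)%E.
Proof.
move=> ab dF cf; rewrite (continuous_FTC2 (F := F) ab) ?EFinB//.
- apply: continuous_in_subspaceT => x /set_mem /=; rewrite in_itv /= => /andP[ax xb].
  exact: cf.
- split.
  + by move=> x; rewrite in_itv /= => /andP[ax xb]; have [] := dF x (ltW ax) (ltW xb).
  + by apply: cvg_at_right_filter; apply: derivable_continuous; have [] := dF a (lexx a) (ltW ab).
  + by apply: cvg_at_left_filter; apply: derivable_continuous; have [] := dF b (ltW ab) (lexx b).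
- by move=> x; rewrite in_itv /= => /andP[ax xb]; have [] := dF x (ltW ax) (ltW xb).
Qed.

Lemma FTC_halfline (f F : R -> R) (a l : R) :
  (forall x, a <= x -> 0 <= f x) ->
  (forall x, a <= x -> derivable F x 1 /\ derive1 F x = f x) ->
  (forall x, a <= x -> {for x, continuous f}) ->
  F x @[x --> +oo] --> l ->
  measurable_fun setT f ->
  (\int[mu]_(x in `]a, +oo[) (f x)%:E = (l - F a)%:E)%E.
Proof.
move=> f0 dF cf Fl mf; rewrite integral_itv_obnd_cbnd; last first.
  by apply/measurable_EFinP; exact: measurable_funTS.
rewrite (ge0_continuous_FTC2y (F := F) (l := l))//.
- apply: continuous_in_subspaceT => x /set_mem /=; rewrite in_itv /= andbT => ax.
  exact: cf.
- by move=> x ax; have [] := dF x (ltW ax).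
- by apply: cvg_at_right_filter; apply: derivable_continuous; have [] := dF a (lexx a).
- by move=> x; rewrite in_itv /= andbT => ax; have [] := dF x (ltW ax).
Qed.

Lemma is_derive_exp_lin (k c x : R) :
  is_derive x 1 (fun s : R => c * expR (k * s)) (c * (k * expR (k * x))).
Proof.
have h1 : is_derive x 1 (fun s : R => k * s) k.
  by apply: is_derive_eq; rewrite -[RHS]mulr1.
have h2 : is_derive x 1 (fun s : R => expR (k * s)) (k * expR (k * x)).
  by rewrite mulrC; exact: (is_derive1_comp (f := expR) (g := fun s => k * s)).
have h3 : is_derive x 1 (c \*: (fun s : R => expR (k * s))) (c *: (k * expR (k * x))).
  exact: is_deriveZ.
exact: h3.
Qed.

Lemma integral_exp_halfline (u : R) : 0 < u ->
  (\int[mu]_(s in `]0%R, +oo[) (expR (- u * s))%:E = (u^-1)%:E)%E.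
Proof.
move=> u0.
rewrite (@FTC_halfline _ (fun s => - u^-1 * expR (- u * s)) 0 0).
- by rewrite mulr0 expR0 mulr1 sub0r opprK.
- by move=> x _; exact: expR_ge0.
- move=> x _; apply: is_derive_derivable; have := is_derive_exp_lin (- u) (- u^-1) x.
  by rewrite mulrA mulrNN mulVf ?gt_eqF// mul1r.
- move=> x _; have [+ _] := is_derive_derivable (is_derive_exp_lin (- u) 1 x) => /derivable_continuous.
  by rewrite (_ : (fun s => 1 * _) = fun s => expR (- u * s))//; apply/funext => s; rewrite mul1r.
- rewrite -[X in _ --> X](mulr0 (- u^-1)); apply: cvgM; first exact: cvg_cst.
  rewrite (_ : (fun x => expR (- u * x)) = (fun z => expR (- z)) \o (fun z => u * z)); last first.
    by apply: eq_fun => x /=; rewrite mulNr.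
  apply: (@cvg_comp _ _ _ _ _ _ (pinfty_nbhs R)); last exact: cvgr_expR.
  exact: gt0_cvgMry.
- by apply: measurableT_comp => //; exact: measurable_funM.
Qed.

Lemma integral_exp_segment (s a b : R) : 0 < s -> a < b ->
  (\int[mu]_(u in `[a, b]) (expR (- u * s))%:E = ((expR (- s * a) - expR (- s * b)) / s)%:E)%E.
Proof.
move=> s0 ab.
under eq_integral do rewrite mulNr mulrC -mulNr.
rewrite (@FTC_segment _ (fun u => - s^-1 * expR (- s * u)) a b ab).
- by congr EFin; field; rewrite gt_eqF.
- move=> x _ _; apply: is_derive_derivable; have := is_derive_exp_lin (- s) (- s^-1) x.
  by rewrite mulrA mulrNN mulVf ?gt_eqF// mul1r.
- move=> x _ _; have [+ _] := is_derive_derivable (is_derive_exp_lin (- s) 1 x) => /derivable_continuous.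
  by rewrite (_ : (fun s' => 1 * _) = fun u => expR (- s * u))//; apply/funext => s'; rewrite mul1r.
Qed.

Lemma integral_inv_segment (a b : R) : 0 < a -> a < b ->
  (\int[mu]_(u in `[a, b]) (u^-1)%:E = (ln b - ln a)%:E)%E.
Proof.
move=> a0 ab; rewrite (@FTC_segment _ (@ln R) a b ab)//.
- by move=> x ax _; apply/is_derive_derivable/is_derive1_ln; exact: lt_le_trans ax.
- by move=> x ax _; apply: inv_continuous; rewrite gt_eqF// (lt_le_trans a0).
Qed.

Lemma integral_inv_pow (p : nat) : (0 < p)%N ->
  (\int[mu]_(s in `]0%R, +oo[) (((1 + s) ^+ p.+1)^-1)%:E = (p%:R^-1)%:E)%E.
Proof.
move=> p0; have pR : 0 < p%:R :> R by rewrite ltr0n.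
have dX (q : nat) (x : R) : 0 <= x ->
    is_derive x 1 (fun s : R => ((1 + s) ^+ q)^-1) (- q%:R * ((1 + x) ^+ q.+1)^-1).
  move=> x0; have x1 : 0 < 1 + x by lra.
  have h1 : is_derive x 1 (fun s : R => 1 + s) 1.
    have h : is_derive x 1 (cst 1 + @id R) (0 + 1) by exact: is_deriveD.
    by rewrite add0r in h; exact: h.
  case: q => [|q].
    rewrite (_ : (fun s : R => _) = cst 1); last by apply/funext => s; rewrite expr0 invr1.
    by rewrite oppr0 mul0r; exact: is_derive_cst.
  have h2 : is_derive x 1 (fun s : R => (1 + s) ^+ q.+1) ((q.+1%:R * (1 + x) ^+ q) *: 1).
    have fX k s : ((fun s : R => 1 + s) ^+ k) s = (1 + s) ^+ k.
      by elim: k => [|k IH]; rewrite ?expr0// !exprS -IH.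
    have := is_deriveX q.+1 h1; rewrite (_ : _ ^+ q.+1 = fun s : R => (1 + s) ^+ q.+1)//.
    by apply/funext => s; exact: fX.
  have h3 : is_derive x 1 (fun s : R => ((1 + s) ^+ q.+1)^-1)
      (- ((1 + x) ^+ q.+1) ^- 2 *: ((q.+1%:R * (1 + x) ^+ q) *: 1)).
    by apply: is_deriveV; rewrite expf_neq0// gt_eqF.
  suff <- : - ((1 + x) ^+ q.+1) ^- 2 *: ((q.+1%:R * (1 + x) ^+ q) *: 1) =
      - q.+1%:R * ((1 + x) ^+ q.+2)^-1 by [].
  have z0 : 1 + x != 0 by rewrite gt_eqF.
  have y0 : (1 + x) ^+ q != 0 by rewrite expf_neq0.
  rewrite /GRing.scale /= !exprS expr0.
  by field; rewrite ?y0 ?z0.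
rewrite (@FTC_halfline _ (fun s => - p%:R^-1 * ((1 + s) ^+ p)^-1) 0 0).
- by rewrite addr0 expr1n invr1 mulr1 sub0r opprK.
- by move=> x x0; rewrite invr_ge0 exprn_ge0//; lra.
- move=> x x0; apply: is_derive_derivable; have h := dX p x x0.
  have h2 : is_derive x 1 (- p%:R^-1 \*: (fun s : R => ((1 + s) ^+ p)^-1))
      (- p%:R^-1 *: (- p%:R * ((1 + x) ^+ p.+1)^-1)) by exact: is_deriveZ.
  suff <- : - p%:R^-1 *: (- p%:R * ((1 + x) ^+ p.+1)^-1) = ((1 + x) ^+ p.+1)^-1 by exact: h2.
  by rewrite /GRing.scale /= mulrA mulrNN mulVf ?gt_eqF// mul1r.
- by move=> x x0; apply: derivable_continuous; have [] := dX p.+1 x x0.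
- rewrite -[X in _ --> X](mulr0 (- p%:R^-1)); apply: cvgM; first exact: cvg_cst.
  apply: (@squeeze_cvgr _ _ _ _ (fun=> 0) (fun s => s^-1)); last first.
  + by apply/gtr0_cvgV0; [exact: nbhs_pinfty_gt|exact: cvg_id].
  + exact: cvg_cst.
  + near=> s; have s0 : 0 < s by near: s; exact: nbhs_pinfty_gt.
    have s1 : 0 < 1 + s by lra.
    rewrite invr_ge0 exprn_ge0 ?(ltW s1)//= lef_pV2 ?posrE ?exprn_gt0//.
    apply: (@le_trans _ _ (1 + s)); first lra.
    by rewrite -[leLHS]expr1; apply: ler_weXn2l => //; lra.
- apply: (measurableT_comp (@measurable_inv R)); apply: measurable_funX.
  exact: measurable_funD.
Unshelve. all: by end_near. Qed.

End RealIntegrals.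

Section Tonelli.
Context d1 d2 (T1 : measurableType d1) (T2 : measurableType d2) (R : realType).
Variables (m1 : {sigma_finite_measure set T1 -> \bar R}) (m2 : {sigma_finite_measure set T2 -> \bar R}).

Lemma tonelli_on (D1 : set T1) (D2 : set T2) (f : T1 * T2 -> \bar R) :
  measurable D1 -> measurable D2 -> measurable_fun setT f -> (forall z, (0 <= f z)%E) ->
  (\int[m1]_(x in D1) \int[m2]_(y in D2) f (x, y) =
   \int[m2]_(y in D2) \int[m1]_(x in D1) f (x, y))%E.
Proof.
move=> mD1 mD2 mf f0.
pose g := f \_ (D1 `*` D2).
have mg : measurable_fun setT g.
  by apply/(measurable_restrictT f); [exact: measurableX|exact: measurable_funTS].
have g0 z : (0 <= g z)%E by rewrite /g patchE; case: ifP.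
transitivity (\int[m1]_x \int[m2]_y g (x, y))%E.
  rewrite integral_mkcond; apply: eq_integral => x _; rewrite patchE.
  case: ifPn => xD; last first.
    rewrite integral0_eq// => y _; rewrite /g patchE ifF//.
    by apply/negbTE; apply: contra xD; rewrite !inE => -[].
  rewrite integral_mkcond; apply: eq_integral => y _; rewrite /g !patchE.
  by rewrite in_setX xD.
rewrite (fubini_tonelli g)//.
rewrite [RHS]integral_mkcond; apply: eq_integral => y _; rewrite patchE.
case: ifPn => yD; last first.
  rewrite integral0_eq// => x _; rewrite /g patchE ifF//.
  by apply/negbTE; apply: contra yD; rewrite !inE => -[].
rewrite [RHS]integral_mkcond; apply: eq_integral => x _; rewrite /g !patchE.
by rewrite in_setX yD andbT.
Qed.

Lemma measurable_integral_on (D2 : set T2) (f : T1 * T2 -> \bar R) :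
  measurable D2 -> measurable_fun setT f -> (forall z, (0 <= f z)%E) ->
  measurable_fun setT (fun x => \int[m2]_(y in D2) f (x, y))%E.
Proof.
move=> mD2 mf f0; pose g := f \_ (setT `*` D2).
have mg : measurable_fun setT g.
  by apply/(measurable_restrictT f); [exact: measurableX|exact: measurable_funTS].
have g0 z : (0 <= g z)%E by rewrite /g patchE; case: ifP.
rewrite (_ : (fun x => _) = fubini_F m2 g); first exact: measurable_fun_fubini_tonelli_F.
apply/funext => x; rewrite /fubini_F [LHS]integral_mkcond; apply: eq_integral => y _.
by rewrite /g !patchE in_setX in_setT.
Qed.

End Tonelli.

Section Frullani.
Variable R : realType.
Local Notation mu := (@lebesgue_measure R).

(** The integrand is the integral of [expR (- u * s)] over [u] between [a] and [b]; exchanging the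
    integrals leaves that of [u^-1]. *)
Lemma frullani (a b : R) : 0 < a -> a <= b ->
  (\int[mu]_(s in `]0%R, +oo[) ((expR (- s * a) - expR (- s * b)) / s)%:E =
   (ln b - ln a)%:E)%E.
Proof.
move=> a0; rewrite le_eqVlt => /orP[/eqP <-|ab].
  by rewrite subrr integral0_eq// => s _; rewrite subrr mul0r.
pose f (z : R * R) : \bar R := (expR (- z.1 * z.2))%:E.
have mf : measurable_fun setT f.
  apply/measurable_EFinP; apply: measurableT_comp => //; apply: measurable_funM => //.
  by apply: measurableT_comp => //; exact: measurable_fst.
have f0 z : (0 <= f z)%E by rewrite lee_fin expR_ge0.
rewrite -(integral_inv_segment a0 ab).
transitivity (\int[mu]_(s in `]0%R, +oo[) \int[mu]_(u in `[a, b]) f (u, s))%E.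
  apply: eq_integral => s /set_mem /=; rewrite in_itv /= andbT => s0.
  by rewrite -(integral_exp_segment s0 ab).
rewrite -(tonelli_on mu mu)//.
apply: eq_integral => u /set_mem /=; rewrite in_itv /= => /andP[au _].
by rewrite /f /= integral_exp_halfline// (lt_le_trans a0).
Qed.

End Frullani.

Section Expectation.
Context d (T : measurableType d) (R : realType) (Pr : probability T R).
Local Notation mu := (@lebesgue_measure R).

(** The order of [A] and [B] makes the Frullani integrand nonnegative, so Tonelli applies before the
    logarithms are known to be integrable; the common value may be infinite. *)
Lemma expect_ln_ratio (A B : T -> R) (psi : R -> R) :
  measurable_fun setT A -> measurable_fun setT B ->
  (forall w, 0 <= A w <= B w) -> {ae Pr, forall w, A w != 0} ->
  (forall s, 0 < s ->
    (\int[Pr]_w (expR (- s * A w) - expR (- s * B w))%:E = (s * psi s)%:E)%E) ->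
  (\int[Pr]_w (ln (B w) - ln (A w))%:E = \int[mu]_(s in `]0%R, +oo[) (psi s)%:E)%E.
Proof.
move=> mA mB AB A0 hpsi.
pose f (z : T * R) : \bar R := ((expR (- z.2 * A z.1) - expR (- z.2 * B z.1)) / z.2)%:E.
have m2 : measurable_fun [set: T * R] (fun z => - z.2).
  by apply: measurableT_comp => //; exact: measurable_snd.
have mf : measurable_fun setT f.
  apply/measurable_EFinP; apply: measurable_funM; last first.
    by apply: (measurableT_comp (@measurable_inv R)); exact: measurable_snd.
  apply: measurable_funB; apply: measurableT_comp => //; apply: measurable_funM => //.
    by apply: measurableT_comp => //; exact: measurable_fst.
  by apply: measurableT_comp => //; exact: measurable_fst.
(* Nonnegativity is needed at every [s]: for [s < 0] numerator and denominator change sign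
   together. *)
have f0 z : (0 <= f z)%E.
  rewrite lee_fin; have /andP[A1 A2] := AB z.1.
  have [s0|s0] := leP 0 z.2.
    by rewrite divr_ge0// subr_ge0 ler_expR !mulNr lerN2 ler_wpM2l.
  apply: mulr_le0; last by rewrite invr_le0 ltW.
  by rewrite subr_le0 ler_expR !mulNr lerN2 ler_wnM2l// ltW.
transitivity (\int[Pr]_w \int[mu]_(s in `]0%R, +oo[) f (w, s))%E.
  apply: ae_eq_integral => //.
  - by apply/measurable_EFinP; apply: measurable_funB; exact: measurableT_comp.
  - exact: (@measurable_integral_on _ _ _ _ _ mu `]0%R, +oo[%classic f).
  - apply: filterS A0 => w A0 _; have /andP[A1 A2] := AB w.
    have A3 : 0 < A w by rewrite lt_neqAle eq_sym A0.
    by rewrite -(frullani A3 A2).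
rewrite (tonelli_on Pr mu)//.
apply: eq_integral => s /set_mem /=; rewrite in_itv /= andbT => s0.
rewrite /f /=.
under eq_integral do rewrite mulrC EFinM.
rewrite ge0_integralZl//; last 2 first.
- by move=> w _; have /andP[A1 A2] := AB w; rewrite lee_fin subr_ge0 ler_expR !mulNr lerN2 ler_pM2l.
- by rewrite lee_fin invr_ge0 ltW.
- by rewrite hpsi// -EFinM mulKf// gt_eqF.
- apply/measurable_EFinP; apply: measurable_funB; apply: measurableT_comp => //.
    exact: measurable_funM.
  exact: measurable_funM.
Qed.

End Expectation.

(** * Means, and integrals of almost everywhere equal functions *)

Section Means.
Import HBNNSimple.
Context d (T : measurableType d) (R : realType) (Pr : probability T R).

Definition has_mean (f : T -> R) (x : R) : Prop :=
  Pr.-integrable setT (EFin \o f) /\ (\int[Pr]_w (f w)%:E = x%:E)%E.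

Lemma has_mean_ex f : Pr.-integrable setT (EFin \o f) -> exists x, has_mean f x.
Proof.
move=> hf; have h := integrable_fin_num measurableT hf.
by exists (fine (\int[Pr]_w (f w)%:E)%E); split => //; rewrite fineK.
Qed.

Lemma has_meanD f g x y : has_mean f x -> has_mean g y ->
  has_mean (fun w => f w + g w) (x + y).
Proof.
move=> [hf ef] [hg eg]; split; first exact: (integrableD measurableT hf hg).
have := integralD_EFin measurableT hf hg; rewrite /= => ->.
by rewrite ef eg.
Qed.

Lemma has_meanZ f x k : has_mean f x -> has_mean (fun w => k * f w) (k * x).
Proof.
move=> [hf ef]; split; first exact: (integrableZl measurableT k hf).
under eq_integral do rewrite EFinM.
by rewrite integralZl// ef.
Qed.

Lemma has_meanB f g x y : has_mean f x -> has_mean g y ->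
  has_mean (fun w => f w - g w) (x - y).
Proof.
move=> hf hg; have := has_meanD hf (has_meanZ (-1) hg); rewrite mulN1r.
by under eq_fun do rewrite mulN1r.
Qed.

Lemma has_mean0 : has_mean (fun=> 0) 0.
Proof.
by split; [exact: integrable0|rewrite integral0].
Qed.

Lemma has_mean_sum (I : Type) (r : seq I) (F : I -> T -> R) (x : I -> R) :
  (forall i, has_mean (F i) (x i)) ->
  has_mean (fun w => \sum_(i <- r) F i w) (\sum_(i <- r) x i).
Proof.
move=> h; elim: r => [|a r IH].
  by under eq_fun do rewrite big_nil; rewrite big_nil; exact: has_mean0.
by under eq_fun do rewrite big_cons; rewrite big_cons; exact: has_meanD.
Qed.

Lemma ae_fin (I : finType) (P : I -> T -> Prop) :
  (forall i, {ae Pr, forall w, P i w}) -> {ae Pr, forall w, forall i, P i w}.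
Proof.
move=> h.
have aux (r : seq I) : {ae Pr, forall w, forall i, i \in r -> P i w}.
  elim: r => [|a r IH]; first exact: aeW.
  apply: filterS2 (h a) IH => w Pa IH i; rewrite inE => /orP[/eqP ->//|]; exact: IH.
by apply: filterS (aux (enum I)) => w h' i; apply: h'; rewrite mem_enum.
Qed.

(** The integral is a supremum over simple functions below [f]. Cutting such a function to [0] on
    the null set [N] keeps its integral and puts it below [g]. *)
Lemma ge0_ae_le_integral (f g : T -> \bar R) :
  (forall w, (0 <= f w)%E) -> (forall w, (0 <= g w)%E) ->
  {ae Pr, forall w, f w = g w} -> (\int[Pr]_w f w <= \int[Pr]_w g w)%E.
Proof.
move=> f0 g0 [N [mN N0 sN]].
rewrite !ge0_integralTE//; apply: ge_ereal_sup => _ /= [h hf <-].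
have mNC : measurable (~` N) by exact: measurableC.
have -> : sintegral Pr h = sintegral Pr (proj_nnsfun h mNC).
  rewrite -[LHS](_ : (\int[Pr]_x (h x)%:E = _)%E); last first.
    by rewrite integral_nnsfun// patch_setT.
  rewrite -[RHS](_ : (\int[Pr]_x (proj_nnsfun h mNC x)%:E = _)%E); last first.
    by rewrite integral_nnsfun// patch_setT.
  apply: ge0_ae_eq_integral => //.
  - exact/measurable_EFinP.
  - exact/measurable_EFinP.
  - by move=> x _; rewrite lee_fin.
  - by move=> x _; rewrite lee_fin.
  - exists N; split => // x /= nx; apply: contrapT => xN; apply: nx => _.
    by rewrite mindicE mem_set// mulr1.
apply: ereal_sup_ubound; exists (proj_nnsfun h mNC) => //= x.
rewrite mindicE; case: (boolP (x \in ~` N)) => [|_]; last by rewrite mulr0.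
rewrite inE => xN; rewrite mulr1; apply: le_trans (hf x) _.
have -> // : f x = g x by apply: contrapT => h'; exact: xN (sN x h').
Qed.

(* No measurability is assumed: that of [beta_DPC_ZF] and [beta_DPC_BD], which are
   built from [sup], [lim] and choice, is not known. *)
Lemma ae_eq_integral_any (f g : T -> \bar R) :
  {ae Pr, forall w, f w = g w} -> (\int[Pr]_w f w = \int[Pr]_w g w)%E.
Proof.
move=> fg; rewrite integralE [RHS]integralE.
have gf : {ae Pr, forall w, g w = f w} by apply: filterS fg => w ->.
have ineq (u v : T -> \bar R) : {ae Pr, forall w, u w = v w} ->
    (\int[Pr]_w u^\+ w <= \int[Pr]_w v^\+ w)%E /\ (\int[Pr]_w u^\- w <= \int[Pr]_w v^\- w)%E.
  move=> uv; split; apply: ge0_ae_le_integral; rewrite ?/funepos ?/funeneg //.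
  - by apply: filterS uv => w; rewrite !funeposE => ->.
  - by apply: filterS uv => w; rewrite !funenegE => ->.
have [p1 n1] := ineq _ _ fg; have [p2 n2] := ineq _ _ gf.
by congr (_ - _)%E; apply/eqP; rewrite eq_le ?p1 ?n1 ?p2 ?n2.
Qed.

End Means.

(** * Mean of the logarithm of a gain *)

Section LogGains.
Context d (T : measurableType d) (R : realType) (Pr : probability T R).
Variables (m n : nat) (H : T -> 'M[R[i]]_(m, n)).
Hypothesis iidH : iid_CN01 Pr H.
Local Notation mu := (@lebesgue_measure R).

Definition log_gain (s : seq 'I_m) (i : 'I_m) w : R := ln (gain (rows_of H s w) (row i (H w))).

(** [ln g] is written [ln (g + 1) - (ln (g + 1) - ln g)], separating large gains from small ones.
    The first term is at most [2 * expR (g / 2)], whose mean is finite by the Laplace transform at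
    [- 1/2]. The second goes through [expect_ln_ratio]: as [1 - expR (- t) <= t], its mean is at
    most the integral of [(1 + t) ^- (n - size s)], finite since the exponent is at least [2]. *)
Lemma integrable_ln_gain i s : i \notin s -> uniq s -> (size s + 2 <= n)%N ->
  Pr.-integrable setT (EFin \o log_gain s i).
Proof.
move=> nis us sn.
have aes := pivots_ae iidH us (ltac:(lia) : (size s <= n)%N).
have gae := gain_gt0_ae iidH nis (ltac:(lia) : (size s < n)%N) aes.
pose g w := gain (rows_of H s w) (row i (H w)).
have mg : measurable_fun setT g := measurable_gain_rows iidH s i.
have g0 w : 0 <= g w := gain_ge0 _ _.
have lap t : -1 < t -> (\int[Pr]_w (expR (- t * g w))%:E = ((1 + t) ^+ size s / (1 + t) ^+ n)%:E)%E.
  by move=> t1; exact: gain_laplace.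
have mg1 : measurable_fun setT (fun w => g w + 1) by exact: measurable_funD.
have i1 : Pr.-integrable setT (EFin \o (fun w => ln (g w + 1))).
  apply: (@le_integrable _ _ _ Pr setT _ _ (fun w => (2 * expR (- (- 2^-1) * g w))%:E)) => //.
  - by apply/measurable_EFinP; exact: measurableT_comp.
  - move=> w _; rewrite /= !ger0_norm ?lee_fin; last 2 first.
    + by rewrite mulr_ge0// expR_ge0.
    + by rewrite ln_ge0// lerDr.
    apply: (@le_trans _ _ (g w)); first by rewrite addrC le_ln1Dx// (lt_le_trans _ (g0 w))// ltrN10.
    have := expR_ge1Dx (- (- 2^-1) * g w); rewrite opprK => h.
    by have := h; lra.
  - apply: (integrableZl (f := fun w => (expR (- (- 2^-1) * g w))%:E) measurableT 2).
    apply/integrableP; split.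
      by apply/measurable_EFinP; apply: measurableT_comp => //; exact: measurable_funM.
    under eq_integral do rewrite /= ger0_norm ?expR_ge0//.
    rewrite lap ?ltry//; lra.
have i2 : Pr.-integrable setT (EFin \o (fun w => ln (g w + 1) - ln (g w))).
  pose psi (t : R) := (1 + t) ^+ size s / (1 + t) ^+ n * (1 - expR (- t)) / t.
  have e : (\int[Pr]_w (ln (g w + 1) - ln (g w))%:E = \int[mu]_(t in `]0%R, +oo[) (psi t)%:E)%E.
    apply: expect_ln_ratio => //.
      by move=> w; rewrite g0 lerDl ler01.
    move=> t t0; have e1 : 0 <= 1 - expR (- t) by rewrite subr_ge0 expR_le1// oppr_le0 ltW.
    rewrite (eq_integral (fun w => (1 - expR (- t))%:E * (expR (- t * g w))%:E)%E).
      rewrite ge0_integralZl//; last first.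
        by apply/measurable_EFinP; apply: measurableT_comp => //; exact: measurable_funM.
      rewrite lap; last lra.
      by rewrite -EFinM /psi; congr EFin; rewrite [RHS]mulrC divfK ?gt_eqF// mulrC.
    by move=> w _; rewrite -EFinM mulrDr expRD mulr1; congr EFin; ring.
  apply/integrableP; split.
    by apply/measurable_EFinP; apply: measurable_funB; exact: measurableT_comp.
  under eq_integral => w _.
    rewrite /= ger0_norm; last first.
      have := g0 w; rewrite le_eqVlt => /orP[/eqP <-|gp]; first by rewrite add0r ln1 ln0// subrr.
      by rewrite subr_ge0 ler_ln ?posrE ?lerDl// addr_gt0.
    over.
  rewrite e; apply: (@le_lt_trans _ _
    (\int[mu]_(t in `]0%R, +oo[) (((1 + t) ^+ (n - size s - 1).+1)^-1)%:E)%E).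
    have psi0 (t : R) : 0 < t -> 0 <= psi t.
      move=> t0; have t1 : 0 <= 1 + t by lra.
      have e1 : 0 <= 1 - expR (- t) by rewrite subr_ge0 expR_le1// oppr_le0 ltW.
      by rewrite /psi divr_ge0 ?(ltW t0)// mulr_ge0// divr_ge0// exprn_ge0.
    apply: ge0_le_integral => //.
    - by move=> t; rewrite /= in_itv /= andbT => t0; rewrite lee_fin; exact: psi0.
    - apply/measurable_EFinP; apply: measurable_funTS; rewrite /psi.
      have m1 : measurable_fun setT (fun t : R => 1 + t) by exact: measurable_funD.
      apply: measurable_funM; last exact: measurable_inv.
      apply: measurable_funM; last first.
        by apply: measurable_funB => //; apply: measurableT_comp => //; exact: measurable_funN.
      apply: measurable_funM; first exact: measurable_funX.
      by apply: (measurableT_comp (@measurable_inv R)); exact: measurable_funX.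
    - apply/measurable_EFinP; apply: measurable_funTS.
      apply: (measurableT_comp (@measurable_inv R)); apply: measurable_funX.
      exact: measurable_funD.
    - move=> t; rewrite /= in_itv /= andbT => t0; rewrite lee_fin /psi.
      have z1 : 0 < 1 + t by lra.
      have -> : (1 + t) ^+ n = (1 + t) ^+ size s * (1 + t) ^+ (n - size s - 1).+1.
        by rewrite -exprD; congr (_ ^+ _); lia.
      rewrite invfM mulrA divff ?mul1r; last by rewrite expf_neq0// gt_eqF.
      rewrite -mulrA ler_piMr ?invr_ge0 ?exprn_ge0 ?(ltW z1)//.
      rewrite ler_pdivrMr// mul1r lerBlDl -lerBlDr.
      by have := expR_ge1Dx (- t); lra.
  by rewrite integral_inv_pow ?ltry//; lia.
rewrite (_ : _ \o _ = EFin \o (fun w => ln (g w + 1) - (ln (g w + 1) - ln (g w)))).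
  exact: (integrableB measurableT i1 i2).
by apply/funext => w /=; congr EFin; rewrite opprB addrC subrK.
Qed.

Lemma log_gain_mean i s : i \notin s -> uniq s -> (size s + 2 <= n)%N ->
  exists x, has_mean Pr (log_gain s i) x.
Proof. by move=> h1 h2 h3; apply: has_mean_ex; exact: integrable_ln_gain. Qed.

(** The two Laplace transforms differ by [t * (1 + t) ^- (n - size s)]; the division by [t] in
    Frullani's integral leaves a power that integrates to [(n - size s - 1)^-1]. *)
Lemma log_gain_mean_cons i b s x : i \notin b :: s -> uniq (b :: s) -> (size s + 3 <= n)%N ->
  has_mean Pr (log_gain (b :: s) i) x ->
  has_mean Pr (log_gain s i) (x + ((n - size s - 1)%:R)^-1).
Proof.
move=> nib ub sn hx; have /= /andP[nbs us] := ub.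
have nis : i \notin s by move: nib; rewrite inE negb_or => /andP[].
have sb : (size (b :: s) < n)%N by apply: leq_trans sn; rewrite addn3 /=.
have aeb := pivots_ae iidH ub (ltnW sb).
have aes := pivots_ae iidH us (ltac:(lia) : (size s <= n)%N).
have gae := gain_gt0_ae iidH nib sb aeb.
have [y hy] := log_gain_mean nis us (ltac:(lia) : (size s + 2 <= n)%N).
pose A w := gain (rows_of H (b :: s) w) (row i (H w)).
pose B w := gain (rows_of H s w) (row i (H w)).
have mA : measurable_fun setT A := measurable_gain_rows iidH (b :: s) i.
have mB : measurable_fun setT B := measurable_gain_rows iidH s i.
have iE (F : T -> R) t q : measurable_fun setT F ->
    (\int[Pr]_w (expR (- t * F w))%:E = q%:E)%E ->
    Pr.-integrable setT (EFin \o (fun w => expR (- t * F w))).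
  move=> mF e; apply/integrableP; split.
    by apply/measurable_EFinP; apply: measurableT_comp => //; exact: measurable_funM.
  under eq_integral do rewrite /= ger0_norm ?expR_ge0//.
  by rewrite e ltry.
have e : (\int[Pr]_w (ln (B w) - ln (A w))%:E =
    \int[mu]_(t in `]0%R, +oo[) (((1 + t) ^+ (n - size s - 1).+1)^-1)%:E)%E.
  apply: expect_ln_ratio => //.
    by move=> w; rewrite /A gain_ge0 gain_cons.
  move=> t t0; have t1 : -1 < t by lra.
  have lA := gain_laplace iidH t1 nib aeb; have lB := gain_laplace iidH t1 nis aes.
  have := integralB_EFin measurableT (iE A t _ mA lA) (iE B t _ mB lB); rewrite /= => ->.
  rewrite (_ : size (b :: s) = (size s).+1)// exprS in lA.
  apply: (etrans (congr2 (fun a b => (a - b)%E) lA lB)); rewrite -EFinB; congr EFin.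
  have -> : (1 + t) ^+ n = (1 + t) ^+ size s * (1 + t) ^+ (n - size s - 1).+1.
    by rewrite -exprD; congr (_ ^+ _); lia.
  have p0 : 0 < 1 + t by lra.
  have X0 k : (1 + t) ^+ k != 0 by rewrite expf_neq0// gt_eqF.
  move: (X0 (size s)) (X0 (n - size s - 1)%N); rewrite exprS.
  move: ((1 + t) ^+ size s) ((1 + t) ^+ (n - size s - 1)) => X Y hX hY.
  by field; rewrite hX hY gt_eqF.
have := has_meanB hy hx; rewrite /has_mean /log_gain => -[_].
rewrite -/A -/B => e2; move: e; rewrite e2 integral_inv_pow; last lia.
by move=> [<-]; rewrite addrC subrK.
Qed.

(* Change of the mean of [log_gain] when [q] rows are removed from the
   conditioning rows, leaving [p]. *)
Fixpoint harmonic_sum (p q : nat) : R :=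
  if q is q'.+1 then harmonic_sum p q' + ((n - (q' + p) - 1)%:R)^-1 else 0.

Lemma log_gain_mean_cat i e s x : i \notin e ++ s -> uniq (e ++ s) ->
  (size e + size s + 2 <= n)%N ->
  has_mean Pr (log_gain (e ++ s) i) x ->
  has_mean Pr (log_gain s i) (x + harmonic_sum (size s) (size e)).
Proof.
elim: e x => [|b e IH] x nis us sn hx; first by rewrite addr0.
have := log_gain_mean_cons nis us _ hx; rewrite size_cat => /(_ (ltac:(move: sn; rewrite /=; lia))) h.
rewrite [harmonic_sum _ _]/=
  (_ : x + _ = x + (n - (size e + size s) - 1)%:R^-1 + harmonic_sum (size s) (size e)).
  apply: IH h.
  - by move: nis; rewrite /= inE negb_or => /andP[].
  - by move: us => /= /andP[].
  - by move: sn => /=; lia.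
by ring.
Qed.

End LogGains.

(** * Gram determinants against zero-forcing gains *)

Section LogVolumes.
Context d (T : measurableType d) (R : realType) (Pr : probability T R).
Variables (m n : nat) (H : T -> 'M[R[i]]_(m, n)).

(* [log_vol s r] is the logarithm of the Gram determinant of [r] projected off
   [s]; in [log_zf] each row of [r] is instead projected off all the others. *)
Fixpoint log_vol (s r : seq 'I_m) w : R :=
  if r is a :: r' then log_gain H s a w + log_vol (a :: s) r' w else 0.

Fixpoint log_zf (s r : seq 'I_m) w : R :=
  if r is a :: r' then log_gain H (r' ++ s) a w + log_zf (a :: s) r' w else 0.

(** Mean of [log_vol] minus mean of [log_zf], for [r] rows over [p] conditioning rows: the head row
    is released from the [r'] rows behind it, then joins the conditioning rows. *)
Fixpoint offset (p r : nat) : R :=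
  if r is r'.+1 then harmonic_sum R n p r' + offset p.+1 r' else 0.

(** Row [a] is conditioned on [r ++ s] in [log_zf] and on [s] alone in [log_vol]. The unknown [z] is
    shared so that it cancels later. *)
Lemma log_vol_mean s r : iid_CN01 Pr H -> uniq (r ++ s) -> (size r + size s < n)%N ->
  exists z, has_mean Pr (log_zf s r) z /\
    has_mean Pr (log_vol s r) (z + offset (size s) (size r)).
Proof.
move=> iidH; elim: r s => [|a r IH] s us sn.
  by exists 0; rewrite /= addr0; split; exact: has_mean0.
have /= /andP[nas us'] := us.
have sz : (size r + size s + 2 <= n)%N by move: sn => /=; lia.
have [x hx] := @log_gain_mean _ _ _ Pr _ _ H iidH a (r ++ s) nas us' (ltac:(rewrite size_cat; exact: sz)).
have hy := log_gain_mean_cat iidH nas us' sz hx.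
have us2 : uniq (r ++ a :: s) by rewrite -cat1s uniq_catCA.
have [|z [h1 h2]] := IH (a :: s) us2; first by move: sn => /=; lia.
exists (x + z); split; first exact: has_meanD.
rewrite [offset _ _]/= addrACA.
exact: (has_meanD hy h2).
Qed.

(** At every stage of the recursion the two lists together contain all rows, so each row is
    conditioned on exactly the others. *)
Lemma log_zfE w s r : uniq (r ++ s) -> (forall j, j \in r ++ s) ->
  log_zf s r w = \sum_(a <- r) ln (zf_gain2 (H w) a).
Proof.
elim: r s => [|a r IH] s us all; first by rewrite big_nil.
have /= /andP[nas us'] := us.
rewrite big_cons /= IH; first last.
- by move=> j; have := all j; rewrite /= !inE !mem_cat !inE orbCA.
- by rewrite -cat1s uniq_catCA.
congr (_ + _); rewrite /log_gain (@zf_gain2E _ _ _ _ _ (r ++ s))// => j.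
have := all j; rewrite /= inE; have [->|//] := eqVneq j a.
by rewrite (negbTE nas).
Qed.

Lemma pivots_catrev (r s : seq 'rV[R[i]]_n) : pivots (catrev r s) -> pivots s.
Proof. by elim: r s => //= a r IH s /IH[]. Qed.

Lemma pivots_rows_catrev w (r s : seq 'I_m) :
  pivots (rows_of H (catrev r s) w) -> pivots (rows_of H s w).
Proof.
have -> : rows_of H (catrev r s) w = catrev (rows_of H r w) (rows_of H s w).
  by elim: r s => //= a r IH s; rewrite IH.
exact: pivots_catrev.
Qed.

(** [catrev r s] is what [s] becomes once [vol] has pushed the rows of [r] onto it, so its pivots
    include every gain that [vol] meets. *)
Lemma log_volE w s r : pivots (rows_of H (catrev r s) w) ->
  0 < vol (rows_of H s w) (rows_of H r w) /\
  ln (vol (rows_of H s w) (rows_of H r w)) = log_vol s r w.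
Proof.
elim: r s => [|a r IH] s ps; first by rewrite /= ln1 ltr01.
have [v0 vE] := IH (a :: s) ps.
have ga : 0 < gain (rows_of H s w) (row a (H w)).
  rewrite lt_neqAle gain_ge0 andbT eq_sym.
  by case: (@pivots_rows_catrev w r (a :: s) ps).
split; first exact: mulr_gt0.
rewrite [vol _ _]/= lnM ?posrE// [log_vol _ _ _]/=; congr (_ + _); exact: vE.
Qed.

End LogVolumes.

Section Offsets.
Variable R : realType.

(** [D] counts the dimensions left by the [p + q] conditioning rows and the row itself. The first
    removal is worth [(D + 1)^-1], and each later one sees one more free dimension. *)
Lemma harmonic_sumE n D p q : n = (D + p + q.+1)%N ->
  harmonic_sum R n p q = \sum_(1 <= j < q.+1) (D + j)%:R^-1.
Proof.
elim: q D => [|q IH] D nE; first by rewrite big_geq.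
rewrite /= (IH D.+1); last by rewrite nE; lia.
rewrite [RHS]big_ltn// addrC; congr (_ + _); first by congr (_%:R^-1); rewrite nE; lia.
by rewrite big_add1; apply: eq_bigr => j _; rewrite addSnnS.
Qed.

(** Double counting: [(D + j)^-1] occurs in the harmonic sums of lengths [j] to [r - 1], that is
    [r - j] times. *)
Lemma offsetE n D p r : n = (D + p + r)%N ->
  offset R n p r = \sum_(1 <= j < r) (r - j)%:R / (D + j)%:R.
Proof.
elim: r p => [|r IH] p nE; first by rewrite big_geq.
rewrite /= (harmonic_sumE nE) (IH p.+1); last by rewrite nE; lia.
transitivity (\sum_(1 <= j < r.+1) ((D + j)%:R^-1 + (r - j)%:R / (D + j)%:R) : R); last first.
  apply: eq_big_nat => j /andP[_ jr].
  by rewrite -[X in X + _]mul1r -mulrDl subSn// -natr1 addrC.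
rewrite big_split /=; congr (_ + _).
case: r {IH nE} => [|r]; first by rewrite !big_geq.
by rewrite [RHS]big_nat_recr//= subnn mul0r addr0.
Qed.

End Offsets.

(** * Power offsets *)

Section Gaps.
Variables (R : realType) (K N M : nat).
Local Notation C := (R[i]).
Local Notation "x %:C" := (real_complex R x).
Implicit Types G : 'M[C]_(K * N, M).

Lemma posdef_gram k n (A : 'M[C]_(k, n)) (v : R) :
  \det (A *m conjT A) = v%:C -> 0 < v -> posdef (A *m conjT A).
Proof.
move=> dA v0.
have uA : A *m conjT A \in unitmx by rewrite unitmxE unitfE dA fmorph_eq0 gt_eqF.
have := posdef_congr (S := conjT A) (@posdef1 R n); rewrite conjTK mulmx1; apply => y Ay.
by apply: (unitmx_cinj uA); rewrite -mulmxA Ay mulmx0.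
Qed.

Lemma gram_det k n (A : 'M[C]_(k, n)) :
  \det (A *m conjT A) = (vol [::] [seq row i A | i <- enum 'I_k])%:C.
Proof. by rewrite -det_cproj_gram mulmx1. Qed.

Lemma beta_DPC_ZFE G : (0 < K * N)%N ->
  0 < vol [::] [seq row i G | i <- enum 'I_(K * N)] -> (forall i, 0 < zf_gain2 G i) ->
  beta_DPC_ZF G = (ln 2)^-1 *
    (ln (vol [::] [seq row i G | i <- enum 'I_(K * N)]) - \sum_i ln (zf_gain2 G i)).
Proof.
move=> m0 v0 g0; have dG := gram_det G.
rewrite /beta_DPC_ZF.
rewrite (capacity_gap m0 (C_DPC_growth m0 (posdef_gram dG v0)) (C_ZF_growth m0 g0)).
by rewrite dG /= log2_prod// /log2 -mulr_suml -mulrBl mulrC.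
Qed.

Lemma beta_DPC_BDE G (v : 'I_K -> R) : (0 < K)%N -> (0 < N)%N ->
  0 < vol [::] [seq row i G | i <- enum 'I_(K * N)] ->
  (forall k, \det (bd_G G k *m conjT (bd_G G k)) = (v k)%:C) -> (forall k, 0 < v k) ->
  beta_DPC_BD G = (ln 2)^-1 *
    (ln (vol [::] [seq row i G | i <- enum 'I_(K * N)]) - \sum_k ln (v k)).
Proof.
move=> K0 N0 v0 dv vk0; have dG := gram_det G.
have m0 : (0 < K * N)%N by rewrite muln_gt0 K0.
rewrite /beta_DPC_BD (capacity_gap m0 (C_DPC_growth m0 (posdef_gram dG v0))
  (C_BD_growth K0 N0 (fun k => posdef_gram (dv k) (vk0 k)))).
under eq_bigr do rewrite dv.
by rewrite dG /= log2_prod// /log2 -mulr_suml -mulrBl mulrC.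
Qed.

End Gaps.

(** * Rows of one user and rows of the others *)

Section UserIndices.
Variables K N : nat.

Definition own (k : 'I_K) : seq 'I_(K * N) := [seq mxvec_index k n | n <- enum 'I_N].
Definition others (k : 'I_K) : seq 'I_(K * N) := [seq a <- enum 'I_(K * N) | a \notin own k].

Lemma mem_own j k n : (mxvec_index j n \in own k) = (j == k).
Proof.
apply/mapP/eqP => [[n' _ /eqP]|->]; last by exists n; rewrite ?mem_enum.
by rewrite mxvec_index_inj => /andP[/eqP].
Qed.

Lemma mem_others j k n : (mxvec_index j n \in others k) = (j != k).
Proof. by rewrite mem_filter mem_own mem_enum andbT. Qed.

Lemma uniq_own_others k : uniq (own k ++ others k).
Proof.
rewrite cat_uniq filter_uniq ?enum_uniq// andbT map_inj_uniq ?enum_uniq//=; last first.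
  by move=> n n' /eqP; rewrite mxvec_index_inj eqxx => /eqP.
by apply/hasPn => a; rewrite mem_filter => /andP[].
Qed.

Lemma mem_own_others k a : a \in own k ++ others k.
Proof. by rewrite mem_cat mem_filter mem_enum andbT orbN. Qed.

Lemma size_own k : size (own k) = N.
Proof. by rewrite size_map size_enum_ord. Qed.

Lemma size_others k : size (others k) = ((K - 1) * N)%N.
Proof.
have /perm_size : perm_eq (own k ++ others k) (enum 'I_(K * N)).
  by apply: uniq_perm; rewrite ?uniq_own_others ?enum_uniq// => a; rewrite mem_own_others mem_enum.
rewrite size_cat size_own size_enum_ord => h.
by move: h => /(congr1 (subn^~ N)); rewrite addKn mulnBl mul1n.
Qed.

End UserIndices.

Theorem theorem5 (R : realType) (d : measure_display) (T : measurableType d)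
  (Pr : probability T R) (K N M : nat) (alpha : R)
  (H : T -> 'M[R[i]]_(K * N, M)) :
  (1 <= K)%N -> (1 < N)%N -> 1 < alpha -> M%:R = alpha * (K * N)%:R ->
  iid_CN01 Pr H ->
  let betabar_DPC_ZF := (\int[Pr]_w (beta_DPC_ZF (H w))%:E)%E in
  let betabar_DPC_BD := (\int[Pr]_w (beta_DPC_BD (H w))%:E)%E in
  let betabar_BD_ZF := (betabar_DPC_ZF - betabar_DPC_BD)%E in
  let S := \sum_(1 <= j < N) (N - j)%:R / ((alpha - 1) * (K * N)%:R + j%:R) in
  betabar_BD_ZF = (log2 (expR 1) * K%:R * S)%:E /\
  ((3 / (K * N)%:R)%:E * betabar_BD_ZF = (3 * log2 (expR 1) / N%:R * S)%:E)%E.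
Proof.
move=> K0 N1 a1 Ma iidH ZF BD BDZF S.
have N0 : (0 < N)%N := ltnW N1.
have m0 : (0 < K * N)%N by rewrite muln_gt0 K0.
have KNM : (K * N < M)%N by rewrite -(ltr_nat R) Ma ltr_pMl// ltr0n.
pose D := (M - K * N)%N.
have DE : D%:R = (alpha - 1) * (K * N)%:R by rewrite natrB ?(ltnW KNM)// Ma mulrBl mul1r.
pose e := enum 'I_(K * N).
have ue : uniq (e ++ [::]) by rewrite cats0 enum_uniq.
have sz0 : (size e + size ([::] : seq 'I_(K * N)) < M)%N by rewrite addn0 size_enum_ord.
have [z0 [_ hv]] := log_vol_mean iidH ue sz0.
(* The mean log-determinant of the whole channel enters both gaps, so only its existence as [v0] is
   kept. *)
move: (z0 + _) hv => v0 hv {z0}.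
have szk (k : 'I_K) : (size (own N k) + size (others N k) < M)%N.
  rewrite size_own size_others. by rewrite mulnBl mul1n subnKC// leq_pmull.
(* For user [k], [z k] is the mean of the summed logarithms of its zero-forcing gains and, up to the
   offset, that of its block-diagonalization log-determinant. *)
have /choice[z hz] k := log_vol_mean iidH (uniq_own_others N k) (szk k).
pose off := \sum_(1 <= j < N) (N - j)%:R / (D + j)%:R : R.
have offS : off = S by apply: eq_bigr => j _; rewrite natrD DE.
have hz2 (k : 'I_K) : has_mean Pr (log_vol H (others N k) (own N k)) (z k + off).
  have [_] := hz k; rewrite size_others size_own (@offsetE _ _ D)//.
  (* The dimensions balance as [M = D + (K - 1) * N + N], so the offset is the same for all
     users. *)
  by rewrite -addnA mulnBl mul1n subnK ?leq_pmull// subnK// ltnW.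
have aeE : {ae Pr, forall w, pivots (rows_of H (catrev e [::]) w)}.
  by apply: (pivots_ae iidH); rewrite catrevE cats0 ?rev_uniq ?enum_uniq// size_rev size_enum_ord ltnW.
have aeU : {ae Pr, forall w, forall k : 'I_K, pivots (rows_of H (catrev (own N k) (others N k)) w)}.
  apply: ae_fin => k; apply: (pivots_ae iidH).
    rewrite catrevE (perm_uniq (_ : perm_eq _ (own N k ++ others N k))) ?uniq_own_others//.
    by rewrite perm_cat2r perm_rev.
  by rewrite catrevE size_cat size_rev ltnW.
have aeZ : {ae Pr, forall w, forall i, 0 < zf_gain2 (H w) i}.
  apply: ae_fin => i; pose s := [seq j <- e | j != i].
  have us : uniq s by rewrite filter_uniq// enum_uniq.
  have ss : (size s < M)%N.
    apply: leq_ltn_trans KNM; rewrite size_filter.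
    by apply: leq_trans (count_size _ _) _; rewrite size_enum_ord.
  have nis : i \notin s by rewrite mem_filter eqxx.
  apply: filterS (gain_gt0_ae iidH nis ss (pivots_ae iidH us (ltnW ss))) => w.
  rewrite (@zf_gain2E _ _ _ _ _ s); last by move=> j; rewrite mem_filter mem_enum andbT.
  by rewrite lt_neqAle gain_ge0 andbT eq_sym.
have hZF : has_mean Pr (fun w => (ln 2)^-1 * (log_vol H [::] e w -
    \sum_(k <- enum 'I_K) log_zf H (others N k) (own N k) w))
    ((ln 2)^-1 * (v0 - \sum_(k <- enum 'I_K) z k)).
  by apply/has_meanZ/has_meanB => //; apply: has_mean_sum => k; case: (hz k).
have hBD : has_mean Pr (fun w => (ln 2)^-1 * (log_vol H [::] e w -
    \sum_(k <- enum 'I_K) log_vol H (others N k) (own N k) w))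
    ((ln 2)^-1 * (v0 - \sum_(k <- enum 'I_K) (z k + off))).
  by apply/has_meanZ/has_meanB => //; exact: has_mean_sum.
have ZFE : ZF = ((ln 2)^-1 * (v0 - \sum_(k <- enum 'I_K) z k))%:E.
  rewrite -(proj2 hZF); apply: ae_eq_integral_any; apply: filterS2 aeE aeZ => w pE pZ.
  have [vp vE] := log_volE pE.
  rewrite beta_DPC_ZFE// vE sum_mxvec_index big_enum; congr (_ * (_ - _))%:E.
  apply: eq_bigr => k _; rewrite log_zfE ?uniq_own_others//; last exact: mem_own_others.
  by rewrite big_map big_enum.
have BDE : BD = ((ln 2)^-1 * (v0 - \sum_(k <- enum 'I_K) (z k + off)))%:E.
  rewrite -(proj2 hBD); apply: ae_eq_integral_any; apply: filterS2 aeE aeU => w pE pU.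
  have [vp vE] := log_volE pE.
  have dk k : \det (bd_G (H w) k *m conjT (bd_G (H w) k)) =
      real_complex R (vol (rows_of H (others N k) w) (rows_of H (own N k) w)).
    rewrite (@bd_gram_det _ _ _ _ _ _ (others N k)).
    - by rewrite /rows_of /own -map_comp.
    - by move=> j n; rewrite mem_others.
    - exact: pivots_rows_catrev (pU k).
    - exact: size_others.
    - by apply: ltnW; apply: leq_ltn_trans (szk k); rewrite leq_addl.
  rewrite (beta_DPC_BDE K0 N0 vp dk); last by move=> k; have [] := log_volE (pU k).
  rewrite vE big_enum; congr (_ * (_ - _))%:E; apply: eq_bigr => k _.
  by have [] := log_volE (pU k).
(* [v0] and all [z k] cancel, [K] copies of [off] remain, and [log2 (expR 1)] is [(ln 2)^-1]. *)
have first : BDZF = (log2 (expR 1) * K%:R * S)%:E.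
  rewrite /BDZF ZFE BDE -EFinB; congr EFin; rewrite -mulrBr big_split /=.
  rewrite /log2 expRK mul1r -mulrA; congr (_ * _).
  rewrite big_const_seq count_predT size_enum_ord iter_addr_0 offS -[S *+ K]mulr_natl.
  by ring.
split; rewrite first// -EFinM; congr EFin.
have NR : N%:R != 0 :> R by rewrite pnatr_eq0 -lt0n.
have KR : K%:R != 0 :> R by rewrite pnatr_eq0 -lt0n.
by rewrite natrM; field; rewrite NR KR.
Qed.
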